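(* Let $X$ be a complex Banach space and $T: X \to X$ a bounded linear operator, with Banach-space adjoint $T^*: X^* \to X^*$. Assume that for every non-empty relatively open subset $U \subseteq \sigma(T)$, the glocal spectral subspace $\mathcal{X}_T(\overline{U})$ is dense in $X$. Then $\mathcal{X}^*_{T^*}(F) = \{0\}$ for every closed set $F \subsetneq \sigma(T^* )$. Moreover: (i) if $\sigma(T^* )$ is not a singleton, then the point spectrum $\sigma_p(T^* )$ is empty; (ii) $T^*$ has Dunford's property $(C)$; (iii) $\sigma_{T^*}(x) = \sigma(T^* )$ for every $x \in X^* \setminus \{0\}$; (iv) $r_{T^*}(x) = r(T^* )$ for every $x \in X^*\setminus\{0\}$; (v) if $M$ is any non-trivial closed $T^*$-invariant subspace of $X^*$, then $\sigma(T^* ) \subseteq \sigma(T^*|_M) \subseteq \eta(\sigma(T^* ))$.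
   Context: For a bounded operator $T$ on a Banach space $X$: $T$ has the single-valued extension property (SVEP) if for every open $U \subseteq \mathbb{C}$ and every analytic $f: U \to X$ with $(T - zI)f(z) = 0$ for all $z \in U$, one has $f \equiv 0$. The local resolvent set $\rho_T(x)$ of $x \in X$ is the union of all open $U \subseteq \mathbb{C}$ on which there is an analytic $f: U\to X$ with $(T-zI)f(z) = x$ for $z\in U$; the local spectrum is $\sigma_T(x) = \mathbb{C}\setminus \rho_T(x)$. For $F \subseteq \mathbb{C}$, the local spectral subspace is $X_T(F) = \{x \in X : \sigma_T(x) \subseteq F\}$. $T$ has Dunford's property $(C)$ if $X_T(F)$ is closed for every closed $F \subseteq \mathbb{C}$. For closed $F \subseteq \mathbb{C}$, the glocal spectral subspace $\mathcal{X}_T(F)$ is the set of $x \in X$ for which there exists an analytic $f: \mathbb{C}\setminus F \to X$ with $(T - zI)f(z) = x$ for all $z \in \mathbb{C}\setminus F$ (for $T^*$ on $X^*$ this is denoted $\mathcal{X}^*_{T^*}(F)$). The local spectral radius is $r_T(x) = \limsup_{n\to\infty}\|T^n x\|^{1/n}$; $r(T)$ is the spectral radius. The full spectrum $\eta(\sigma(T))$ is the union of $\sigma(T)$ with all bounded connected components of $\mathbb{C}\setminus\sigma(T)$. *)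

(* Defs.v *)
From HB Require Import structures.
From mathcomp Require Import all_boot all_order all_algebra.
From mathcomp Require Import all_classical all_reals all_analysis.
From mathcomp Require Import complex.
Set Implicit Arguments. Unset Strict Implicit. Unset Printing Implicit Defensive.
Import Order.TTheory GRing.Theory Num.Theory.
Import numFieldNormedType.Exports.
Local Open Scope ring_scope.
Local Open Scope classical_set_scope.

Section LocalSpectralTheory.
Variables (K : numFieldType) (V : normedModType K).

(* f is (complex-)analytic on the open set U: complex differentiable at each point *)
Definition holo_on (U : set K^o) (f : K^o -> V) : Prop :=
  forall z, U z -> derivable f z 1.

(* spectrum of the restriction of A to the (invariant, closed) subspace M, i.e.
   the set of l such that (A - l I)|_M has no bounded (= continuous) linear inverse
   on M.  With M = setT this is the usual spectrum sigma(A). *)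
Definition spectrum_on (M : set V) (A : V -> V) : set K^o :=
  [set l | ~ exists S : V -> V,
      [/\ (forall x, M x -> M (S x)),
          (forall a x y, M x -> M y -> S (a *: x + y) = a *: S x + S y),
          {within M, continuous S},
          (forall x, M x -> S (A x - l *: x) = x) &
          (forall x, M x -> A (S x) - l *: S x = x)]].

Definition spectrum (A : V -> V) : set K^o := spectrum_on setT A.

Definition point_spectrum (A : V -> V) : set K^o :=
  [set l | exists x : V, x != 0 /\ A x = l *: x].

Definition local_resolvent (A : V -> V) (x : V) : set K^o :=
  [set l | exists (U : set K^o) (f : K^o -> V),
     [/\ open U, U l, holo_on U f & forall z, U z -> A (f z) - z *: f z = x]].

Definition local_spectrum (A : V -> V) (x : V) : set K^o :=
  ~` local_resolvent A x.

Definition local_spectral_subspace (A : V -> V) (F : set K^o) : set V :=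
  [set x | local_spectrum A x `<=` F].

Definition property_C (A : V -> V) : Prop :=
  forall F : set K^o, closed F -> closed (local_spectral_subspace A F).

Definition glocal_subspace (A : V -> V) (F : set K^o) : set V :=
  [set x | exists f : K^o -> V,
     holo_on (~` F) f /\ forall z, ~ F z -> A (f z) - z *: f z = x].

Definition closed_subspace (M : set V) : Prop :=
  [/\ M 0, (forall a x y, M x -> M y -> M (a *: x + y)) & closed M].

Definition op_invariant (A : V -> V) (M : set V) : Prop :=
  forall x, M x -> M (A x).

End LocalSpectralTheory.

Definition full_spectrum (K : numFieldType) (S : set K^o) : set K^o :=
  S `|` [set z | ~ S z /\ bounded_set (connected_component (~` S) z)].

(* Y (with the pairing [pair]) is (an isometric copy of) the Banach-space dual X^* of X:
   y |-> pair y is a linear bijection from Y onto the continuous linear functionals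
   on X, and ||y|| = sup_{||x|| <= 1} |pair y x| (the operator norm). *)
Definition dual_pairing (K : numFieldType) (X Y : normedModType K)
    (pair : Y -> X -> K) : Prop :=
  (forall y a x1 x2, pair y (a *: x1 + x2) = a * pair y x1 + pair y x2) /\
  (forall y, continuous (pair y : X -> K^o)) /\
  (forall a y1 y2 x, pair (a *: y1 + y2) x = a * pair y1 x + pair y2 x) /\
  (forall phi : X -> K,
      (forall a x1 x2, phi (a *: x1 + x2) = a * phi x1 + phi x2) ->
      continuous (phi : X -> K^o) -> exists y, forall x, pair y x = phi x) /\
  (forall y x, `|pair y x| <= `|y| * `|x|) /\
  (forall y (e : K), 0 < e -> exists x, `|x| <= 1 /\ `|y| - e < `|pair y x|).

Section Radii.
Variables (R : realType) (V : normedModType R[i]).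

Definition rnorm (x : V) : R := complex.Re `|x|.

Definition local_spectral_radius (A : V -> V) (x : V) : R :=
  limn_sup (fun n : nat => powR (rnorm (iter n A x)) (n%:R)^-1).

Definition spectral_radius (A : V -> V) : R :=
  sup [set complex.Re `|l| | l in spectrum A].

End Radii.

(* Main.v *)
(** Functions are only assumed complex differentiable, so everything rests on
    Goursat's theorem on rectangles, proved by bisection.  Applied to [h (exp w)],
    whose boundary integrals over the horizontal sides cancel by periodicity, it shows
    that circular means of a holomorphic [h] do not depend on the radius; Liouville's
    theorem and Cauchy's estimate for the Laurent coefficients at infinity follow.

    Write [T'] for the adjoint.  Let [y] have a global solution [g] of
    [(T' - z) g(z) = y] off a closed [F] missing some [l] in [sigma(T')].  The closure
    of a small disc [U] around [l] in [sigma(T)] is disjoint from [F].  For [x] in the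
    glocal subspace of [closure U], with solution [f], the functions [<g(z), x>] and
    [<y, f(z)>] agree where both are defined, so they glue to an entire function that
    tends to [0] at infinity; hence [<y, x> = 0].  By density [y = 0].

    An eigenvector [y] of [T'] for [l] has the solution [y / (l - z)] off [{l}], so an
    eigenvalue forces [sigma(T') = {l}].  Hence [T'] has the single-valued extension
    property, local solutions glue, and every nonzero [y] has full local spectrum.
    Property (C), the local radii and the lower bound for [sigma(T'|M)] follow.  For
    the upper bound, the points [z] whose resolvent preserves [M] form a clopen subset
    of the resolvent set containing all large [z]. *)
Require Import Defs.
From HB Require Import structures.
From mathcomp Require Import all_boot all_order all_algebra.
From mathcomp Require Import all_classical all_reals all_analysis.
From mathcomp Require Import complex ring lra.
Import Order.TTheory GRing.Theory Num.Theory.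
Import numFieldNormedType.Exports.
Local Open Scope ring_scope.
Local Open Scope classical_set_scope.
Set Implicit Arguments.
Unset Strict Implicit.

Local Notation Re := (@complex.Re _).
Local Notation Im := (@complex.Im _).

(** * Norms and complex derivatives in terms of real numbers *)

Section RealNorm.
Variables (R : realType) (V : normedModType R[i]).
Implicit Types (x y : V) (a : R[i]).

Lemma rnormE x : `|x| = (rnorm x)%:C%C.
Proof. by rewrite /rnorm RRe_real ?normr_real. Qed.

Lemma rnorm_ge0 x : 0 <= rnorm x.
Proof. by rewrite -ler0c -rnormE. Qed.

Lemma rnormD x y : rnorm (x + y) <= rnorm x + rnorm y.
Proof. by rewrite -lecR rmorphD /= -!rnormE ler_normD. Qed.

Lemma rnormN x : rnorm (- x) = rnorm x.
Proof. by rewrite /rnorm normrN. Qed.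

Lemma rnormBC x y : rnorm (x - y) = rnorm (y - x).
Proof. by rewrite -rnormN opprB. Qed.

Lemma rnormB x y : rnorm (x - y) <= rnorm x + rnorm y.
Proof. by rewrite -[rnorm y]rnormN rnormD. Qed.

Lemma rnorm0 : rnorm (0 : V) = 0.
Proof. by rewrite /rnorm normr0. Qed.

Lemma rnorm_eq0 x : (rnorm x == 0) = (x == 0).
Proof. by rewrite -(normr_eq0 x) rnormE -(inj_eq (@complexI R)). Qed.

Lemma rnorm_gt0 x : (0 < rnorm x) = (x != 0).
Proof. by rewrite lt_neqAle rnorm_ge0 andbT eq_sym rnorm_eq0. Qed.

Lemma rnorm_small x : (forall e, 0 < e -> rnorm x <= e) -> x = 0.
Proof.
move=> h; apply/eqP; rewrite -rnorm_eq0 eq_le rnorm_ge0 andbT.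
by apply/ler_addgt0Pl => e e0; rewrite addr0 h.
Qed.

Lemma nbhs_rnormP x (A : set V) :
  nbhs x A <-> exists2 e : R, 0 < e & forall y, rnorm (y - x) < e -> A y.
Proof.
split.
  move=> /nbhs_normP[e /= e0 eA].
  have re : e = (Re e)%:C%C by rewrite RRe_real // gtr0_real.
  exists (Re e); first by rewrite -ltcR -re.
  by move=> y yx; apply: eA => /=; rewrite distrC rnormE re ltcR.
move=> [e e0 eA]; apply/nbhs_normP; exists e%:C%C; first by rewrite /= ltcR.
by move=> y /=; rewrite distrC rnormE ltcR => /eA.
Qed.

Lemma open_rnormP (A : set V) :
  open A <-> forall x, A x ->
    exists2 e : R, 0 < e & forall y, rnorm (y - x) < e -> A y.
Proof.
rewrite openE; split=> [h x /h /nbhs_rnormP //|h x /h ?]; exact/nbhs_rnormP.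
Qed.

Lemma closure_rnormP (A : set V) x :
  closure A x <-> forall e : R, 0 < e -> exists2 y, A y & rnorm (y - x) < e.
Proof.
split.
  move=> h e e0; have [|y [Ay yx]] := h [set y | rnorm (y - x) < e].
    by apply/nbhs_rnormP; exists e.
  by exists y.
move=> h B /nbhs_rnormP[e e0 eB]; have [y Ay yx] := h e e0.
by exists y; split=> //; apply: eB.
Qed.

End RealNorm.

Local Notation cnorm := (@rnorm _ (_[i]^o)).

Section ComplexNorm.
Variables (R : realType).
Implicit Types (a b : R[i]).

Lemma rnormZ (V : normedModType R[i]) a (x : V) :
  rnorm (a *: x) = cnorm a * rnorm x.
Proof. by rewrite {1}/rnorm normrZ !rnormE -rmorphM. Qed.

Lemma cnormM a b : cnorm (a * b) = cnorm a * cnorm b.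
Proof. exact: (@rnormZ (R[i]^o)). Qed.

Lemma cnormE a : cnorm a = Num.sqrt ((Re a) ^+ 2 + (Im a) ^+ 2).
Proof. by rewrite /rnorm normc_def. Qed.

Lemma cnormr (r : R) : cnorm r%:C%C = `|r|.
Proof. by rewrite cnormE /= expr0n addr0 sqrtr_sqr. Qed.

Lemma cnorm1 : cnorm (1 : R[i]) = 1.
Proof. by rewrite (cnormr 1) normr1. Qed.

Lemma cnormV a : cnorm a^-1 = (cnorm a)^-1.
Proof. by rewrite /rnorm normfV rnormE -fmorphV. Qed.

Lemma cnormX a n : cnorm (a ^+ n) = cnorm a ^+ n.
Proof. by elim: n => [|n ih]; rewrite ?cnorm1 // !exprS cnormM ih. Qed.

Lemma normRe_le a : `|Re a| <= cnorm a.
Proof. by rewrite cnormE -sqrtr_sqr ler_wsqrtr // lerDl sqr_ge0. Qed.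

Lemma normIm_le a : `|Im a| <= cnorm a.
Proof. by rewrite cnormE -sqrtr_sqr ler_wsqrtr // lerDr sqr_ge0. Qed.

Lemma cnorm_le a : cnorm a <= `|Re a| + `|Im a|.
Proof.
have h : 0 <= `|Re a| + `|Im a| by rewrite addr_ge0.
rewrite cnormE -(ger0_norm h) -sqrtr_sqr ler_wsqrtr //.
rewrite sqrrD !real_normK ?num_real //.
by rewrite lerD2r lerDl mulrn_wge0 // mulr_ge0.
Qed.

End ComplexNorm.

Section Cdiff.
Variables (R : realType) (V : normedModType R[i]).
Implicit Types (f g : R[i]^o -> V) (z w : R[i]).

(** First-order expansion with real [e] and [del]; the non-strict bound includes [w = z], so no
    punctured neighbourhood or division occurs. *)
Definition has_cderiv f z (d : V) := forall e : R, 0 < e ->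
  exists2 del : R, 0 < del & forall w, cnorm (w - z) < del ->
    rnorm (f w - f z - (w - z) *: d) <= e * cnorm (w - z).

Lemma derivable_cderiv f z : derivable f z 1 <-> exists d, has_cderiv f z d.
Proof.
split.
  move=> /cvg_ex[d /= fd]; exists d => e e0.
  have : 0 < e%:C%C by rewrite ltcR.
  move/cvgrPdist_le : fd => /[apply].
  rewrite -nbhs_nearE => /nbhs_rnormP[del del0 H].
  exists del => // w wz; have [->|wz0] := eqVneq w z.
    by rewrite !subrr scale0r subrr !rnorm0 mulr0.
  have wz1 : w - z != 0 by rewrite subr_eq0.
  have /H : rnorm ((w - z : R[i]^o) - 0) < del by rewrite subr0.
  move=> /(_ wz1) /=; rewrite rnormE lecR scaler1 subrK => h.
  have -> : f w - f z - (w - z) *: d = - ((w - z) *: (d - (w - z)^-1 *: (f w - f z))).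
    by rewrite scalerBr scalerA divff // scale1r opprB.
  by rewrite rnormN rnormZ mulrC ler_wpM2r ?rnorm_ge0.
move=> [d fd]; apply/cvg_ex; exists d => /=; apply/cvgrPdist_le => e e0.
have re : e = (Re e)%:C%C by rewrite RRe_real // gtr0_real.
have e0' : 0 < Re e by rewrite -ltcR -re.
have [del del0 H] := fd _ e0'.
rewrite -nbhs_nearE; apply/nbhs_rnormP; exists del => // h; rewrite subr0 => hd h0.
have := H (h + z); rewrite addrK => /(_ hd) H1.
rewrite rnormE re lecR scaler1.
have hn : 0 < cnorm h by rewrite rnorm_gt0.
rewrite -(ler_pM2l hn) -rnormZ scalerBr scalerA divff // scale1r.
by rewrite rnormBC [X in _ <= X]mulrC.
Qed.

Lemma cderiv_continuous f z d : has_cderiv f z d -> forall e : R, 0 < e ->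
  exists2 del : R, 0 < del & forall w, cnorm (w - z) < del ->
    rnorm (f w - f z) <= e.
Proof.
move=> fd e e0; have [del del0 H] := fd _ (@ltr01 R).
have C0 : 0 < 1 + rnorm d by rewrite ltr_wpDr ?rnorm_ge0.
exists (Num.min del (e / (1 + rnorm d))); first by rewrite lt_min del0 divr_gt0.
move=> w; rewrite lt_min => /andP[/H h1 h2].
rewrite -[f w - f z](subrK ((w - z) *: d)).
apply: (le_trans (rnormD _ _)); apply: (le_trans (lerD h1 (lexx _))).
rewrite rnormZ mul1r -[X in X + _]mulr1 -mulrDr.
by rewrite -ler_pdivlMr // ltW.
Qed.

Lemma has_cderiv_congr f g z d (del : R) : 0 < del ->
  (forall w, cnorm (w - z) < del -> f w = g w) ->
  has_cderiv f z d -> has_cderiv g z d.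
Proof.
move=> del0 fg fd e /fd[d1 d10 H].
exists (Num.min del d1); first by rewrite lt_min del0.
move=> w; rewrite lt_min => /andP[h1 /H]; rewrite !fg //.
by rewrite subrr rnorm0.
Qed.

(** The remainder is [(w - z) *: (phi w - phi z)], which is of second order when the difference
    quotient [phi] is Lipschitz at [z]. This is how resolvents are differentiated below. *)
Lemma has_cderiv_slope f z (phi : R[i] -> V) (del C : R) : 0 < del ->
  (forall w, cnorm (w - z) < del -> f w - f z = (w - z) *: phi w) ->
  (forall w, cnorm (w - z) < del -> rnorm (phi w - phi z) <= C * cnorm (w - z)) ->
  has_cderiv f z (phi z).
Proof.
move=> del0 fphi phiC e e0.
have C0 : 0 < 1 + `|C| by rewrite ltr_wpDr.
exists (Num.min del (e / (1 + `|C|))); first by rewrite lt_min del0 divr_gt0.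
move=> w; rewrite lt_min => /andP[h1 h2].
rewrite fphi // -scalerBr rnormZ mulrC ler_wpM2r ?rnorm_ge0 //.
apply: (le_trans (phiC _ h1)).
move: h2; rewrite ltr_pdivlMr // mulrC => /ltW; apply: le_trans.
rewrite ler_wpM2r ?rnorm_ge0 //; apply: (le_trans (ler_norm _)).
by rewrite lerDr.
Qed.

End Cdiff.

(** * Completeness and geometric series *)

Section Complete.
Variables (R : realType) (V : completeNormedModType R[i]).

Lemma complete_rnorm (u : nat -> V) :
  (forall e : R, 0 < e -> exists N, forall m n, (N <= m)%N -> (N <= n)%N ->
     rnorm (u m - u n) <= e) ->
  exists l, forall e : R, 0 < e -> exists N, forall n, (N <= n)%N ->
     rnorm (u n - l) <= e.
Proof.
move=> h.
have : cauchy (u @ \oo).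
  apply/cauchy_exP => e e0.
  have re : e = (Re e)%:C%C by rewrite RRe_real // gtr0_real.
  have e0' : 0 < Re e / 2 by rewrite divr_gt0 // -ltcR -re.
  have [N HN] := h _ e0'; exists (u N); exists N => // n /= Nn.
  rewrite -ball_normE /= re rnormE ltcR.
  apply: (le_lt_trans (HN _ _ (leqnn _) Nn)).
  by rewrite ltr_pdivrMr // ltr_pMr ?ltr1n // -ltcR -re.
move=> /cauchy_cvgP /cvg_ex[l ul]; exists l => e e0.
have : 0 < e%:C%C by rewrite ltcR.
move/cvgrPdist_le : ul => /[apply] -[N _ HN]; exists N => n Nn.
by move: (HN n Nn); rewrite /= rnormE lecR rnormBC.
Qed.

Lemma geometric_lt (q e C : R) : 0 <= q -> q < 1 -> 0 < e ->
  exists N, forall n, (N <= n)%N -> C * q ^+ n <= e.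
Proof.
move=> q0 q1 e0.
have : geometric C q @ \oo --> (0 : R) by apply: cvg_geometric; rewrite ger0_norm.
move/cvgrPdist_le => /(_ e e0)[N _ HN]; exists N => n /HN /=.
by rewrite sub0r normrN => /(le_trans (ler_norm _)).
Qed.

(** The tail estimate is stated for every [n]: large [n] gives convergence, and [n = 0] bounds the
    sum itself. *)
Lemma geometric_series_cvg (v : nat -> V) (C q : R) : 0 <= q -> q < 1 ->
  (forall n, rnorm (v n) <= C * q ^+ n) ->
  exists l, forall n, rnorm (l - \sum_(k < n) v k) <= C / (1 - q) * q ^+ n.
Proof.
move=> q0 q1 vq; have q1' : 0 < 1 - q by rewrite subr_gt0.
have C0 : 0 <= C.
  by move: (vq 0%N); rewrite expr0 mulr1; apply: le_trans; exact: rnorm_ge0.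
(* Keeping the exact difference [q ^+ n - q ^+ (n + m)] lets the induction on [m] close. *)
have tail n m : rnorm (\sum_(k < n + m) v k - \sum_(k < n) v k)
    <= C / (1 - q) * (q ^+ n - q ^+ (n + m)).
  elim: m => [|m ih]; first by rewrite addn0 !subrr rnorm0 mulr0.
  rewrite addnS big_ord_recr /= addrAC.
  apply: (le_trans (rnormD _ _)); apply: (le_trans (lerD ih (vq _))).
  rewrite le_eqVlt; apply/orP; left; apply/eqP; rewrite exprS.
  by field; rewrite gt_eqF.
have tail' n m : (n <= m)%N -> rnorm (\sum_(k < m) v k - \sum_(k < n) v k)
    <= C / (1 - q) * q ^+ n.
  move=> nm; rewrite -(subnKC nm); apply: (le_trans (tail _ _)).
  rewrite ler_wpM2l ?divr_ge0 ?(ltW q1') // lerBlDr lerDl exprn_ge0 //.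
have [|l Hl] := @complete_rnorm (fun n => \sum_(k < n) v k).
  move=> e e0; have [N HN] := @geometric_lt q e (C / (1 - q)) q0 q1 e0.
  exists N => m n Nm Nn; case: (leqP m n) => mn.
    by rewrite rnormBC (le_trans (tail' _ _ mn)) // HN.
  by rewrite (le_trans (tail' _ _ (ltnW mn))) // HN.
exists l => n; apply/ler_addgt0Pl => e e0.
have [N HN] := Hl e e0.
have h1 := HN _ (leq_maxl N n); have h2 := tail' _ _ (leq_maxr N n).
rewrite -[l](subrK (\sum_(k < maxn N n) v k)) -addrA.
by apply: (le_trans (rnormD _ _)); rewrite lerD // rnormBC.
Qed.

End Complete.

(** * Goursat's theorem on rectangles *)

Section SegmentIntegral.
Variable R : realType.
Implicit Types (a b c k : R) (f g : R -> R).

Definition segint a b f : R := (\int[lebesgue_measure]_(x in `[a, b]) f x)%R.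

Definition contseg a b f := {within `[a, b], continuous f}.

Lemma contseg_sub a b a' b' f : a <= a' -> b' <= b ->
  contseg a b f -> contseg a' b' f.
Proof.
move=> aa bb; apply: continuous_subspaceW => x /=; rewrite !in_itv /=.
by move=> /andP[h1 h2]; rewrite (le_trans aa) // (le_trans h2).
Qed.

Lemma contseg_cst a b k : contseg a b (fun=> k).
Proof. by apply: continuous_subspaceT => x; exact: cvg_cst. Qed.

Lemma contsegB a b f g : contseg a b f -> contseg a b g ->
  contseg a b (fun x => f x - g x).
Proof. by move=> cf cg x; apply: cvgB; [exact: cf|exact: cg]. Qed.

Lemma contseg_integrable a b f : contseg a b f ->
  lebesgue_measure.-integrable `[a, b] (EFin \o f).
Proof.
move=> cf; apply: continuous_compact_integrable => //.
exact: segment_compact.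
Qed.

Lemma segint_cst a b k : a <= b -> segint a b (fun=> k) = k * (b - a).
Proof.
move=> ab; rewrite /segint Rintegral_cst //= lebesgue_measure_itv /= lte_fin.
have [//|ba] := ltP a b.
by rewrite (@le_anti _ _ a b) ?ab // subrr.
Qed.

Lemma segintB a b f g : contseg a b f -> contseg a b g ->
  segint a b (fun x => f x - g x) = segint a b f - segint a b g.
Proof. by move=> cf cg; rewrite /segint RintegralB //; exact: contseg_integrable. Qed.

Lemma eq_segint a b f g : (forall x, a <= x <= b -> f x = g x) ->
  segint a b f = segint a b g.
Proof.
by move=> fg; apply: eq_Rintegral => x; rewrite inE /= in_itv /= => /fg.
Qed.

Lemma segint_split a b c f : a <= c -> c <= b -> contseg a b f ->
  segint a b f = segint a c f + segint c b f.
Proof.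
move=> ac cb cf; apply/eqP; rewrite addrC -subr_eq; apply/eqP.
rewrite /segint Rintegral_itvB ?bnd_simp //; last exact: contseg_integrable.
rewrite Rintegral_itv_obnd_cbnd //.
apply: integrableS (contseg_integrable (contseg_sub ac (lexx b) cf)) => //.
exact: subset_itv_oc_cc.
Qed.

Lemma segint_le a b f k : a <= b -> contseg a b f ->
  (forall x, a <= x <= b -> `|f x| <= k) -> `|segint a b f| <= k * (b - a).
Proof.
move=> ab cf fk; rewrite -segint_cst //.
apply: le_trans (le_normr_Rintegral _ _) _ => //; first exact: contseg_integrable.
apply: le_Rintegral => //.
- apply: contseg_integrable => x; apply: cvg_norm; exact: cf.
- by apply: contseg_integrable; exact: contseg_cst.
Qed.

End SegmentIntegral.

Section Bisection.
Variables (R : realType) (Phi : R -> R -> R -> R -> R) (a b c d : R).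
Hypotheses (ab : a <= b) (cd : c <= d).
Hypothesis split1 : forall a' b' c' d' m, a <= a' -> a' <= m -> m <= b' ->
  b' <= b -> c <= c' -> c' <= d' -> d' <= d ->
  Phi a' b' c' d' = Phi a' m c' d' + Phi m b' c' d'.
Hypothesis split2 : forall a' b' c' d' m, a <= a' -> a' <= b' -> b' <= b ->
  c <= c' -> c' <= m -> m <= d' -> d' <= d ->
  Phi a' b' c' d' = Phi a' b' c' m + Phi a' b' m d'.
Hypothesis local : forall x y, a <= x <= b -> c <= y <= d ->
  forall e, 0 < e -> exists2 del, 0 < del &
    forall a' b' c' d', a <= a' -> a' <= x <= b' -> b' <= b ->
      c <= c' -> c' <= y <= d' -> d' <= d -> b' - a' < del -> d' - c' < del ->
      `|Phi a' b' c' d'| <= e * ((b' - a') + (d' - c')) ^+ 2.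

Let L n : R := (b - a) / 2 ^+ n.
Let M n : R := (d - c) / 2 ^+ n.

Let sq (n : nat) (p : R * R) := Phi p.1 (p.1 + L n) p.2 (p.2 + M n).
Let inside n (p : R * R) :=
  [/\ a <= p.1, p.1 + L n <= b, c <= p.2 & p.2 + M n <= d].

Let Lge0 n : 0 <= L n.
Proof. by rewrite divr_ge0 ?subr_ge0 ?exprn_ge0. Qed.
Let Mge0 n : 0 <= M n.
Proof. by rewrite divr_ge0 ?subr_ge0 ?exprn_ge0. Qed.
Let half_double (t : R) n : t / 2 ^+ n.+1 + t / 2 ^+ n.+1 = t / 2 ^+ n.
Proof. by rewrite exprS; field; rewrite expf_neq0. Qed.
Let LS n : L n.+1 + L n.+1 = L n. Proof. exact: half_double. Qed.
Let MS n : M n.+1 + M n.+1 = M n. Proof. exact: half_double. Qed.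

(** By the triangle inequality one of the four quarters carries at least a quarter of the absolute
    value. The implication stands under the existential so that [choice] yields a total function. *)
Let step n p : exists q, inside n p ->
  [/\ inside n.+1 q, `|sq n p| <= 4 * `|sq n.+1 q|,
      p.1 <= q.1 <= p.1 + L n - L n.+1 & p.2 <= q.2 <= p.2 + M n - M n.+1].
Proof.
case: (EM (inside n p)) => [|nin]; last by exists p.
case: p => x y [/= h1 h2 h3 h4].
have l0 := Lge0 n.+1; have m0 := Mge0 n.+1; have ls := LS n; have ms := MS n.
pose q00 := (x, y); pose q10 := (x + L n.+1, y).
pose q01 := (x, y + M n.+1); pose q11 := (x + L n.+1, y + M n.+1).
have E : sq n (x, y) = sq n.+1 q00 + sq n.+1 q10 + (sq n.+1 q01 + sq n.+1 q11).
  rewrite /sq /= (@split2 _ _ _ _ (y + M n.+1)); try lra.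
  rewrite (@split1 _ _ _ _ (x + L n.+1)); try lra.
  rewrite [in X in _ + X](@split1 _ _ _ _ (x + L n.+1)); try lra.
  by rewrite -!addrA MS LS.
have : exists q, `|sq n (x, y)| <= 4 * `|sq n.+1 q| /\
   [\/ q = q00, q = q10, q = q01 | q = q11].
  apply: contrapT => /forallNP H.
  have H' q : [\/ q = q00, q = q10, q = q01 | q = q11] ->
      4 * `|sq n.+1 q| < `|sq n (x, y)|.
    move=> hq; rewrite ltNge; apply/negP => hle; exact: (H q).
  have := H' q00 (Or41 _ _ _ erefl); have := H' q10 (Or42 _ _ _ erefl).
  have := H' q01 (Or43 _ _ _ erefl); have := H' q11 (Or44 _ _ _ erefl).
  have := ler_normD (sq n.+1 q00 + sq n.+1 q10) (sq n.+1 q01 + sq n.+1 q11).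
  have := ler_normD (sq n.+1 q00) (sq n.+1 q10).
  have := ler_normD (sq n.+1 q01) (sq n.+1 q11).
  rewrite -E; lra.
case=> q [hq hq']; exists q => _; split=> //; case: hq' => -> /=;
  try split; rewrite /=; lra.
Qed.

(** Abstract Goursat argument for a function of rectangles that is additive under cuts. After [n]
    bisections the value has lost at most a factor [4 ^+ n], while the local bound is quadratic in
    side lengths that shrink by [2 ^+ n]; the two factors cancel and an arbitrary [e] remains. *)
Lemma bisection_eq0 : Phi a b c d = 0.
Proof.
have /choice[f Hf] : forall np : nat * (R * R), exists q, inside np.1 np.2 ->
  [/\ inside np.1.+1 q, `|sq np.1 np.2| <= 4 * `|sq np.1.+1 q|,
      np.2.1 <= q.1 <= np.2.1 + L np.1 - L np.1.+1 &
      np.2.2 <= q.2 <= np.2.2 + M np.1 - M np.1.+1].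
  by move=> -[n p]; exact: step.
pose s := fix s n := if n is m.+1 then f (m, s m) else (a, c).
have ins n : inside n (s n).
  elim: n => [|n ih]; last by have [] := Hf (n, s n) ih.
  split=> //=; rewrite /L /M expr0 divr1; lra.
have E0 : sq 0 (s 0%N) = Phi a b c d.
  by rewrite /sq /= /L /M expr0 !divr1 !subrKC.
have large n : `|Phi a b c d| <= 4 ^+ n * `|sq n (s n)|.
  elim: n => [|n ih]; first by rewrite E0 mul1r.
  have [_ h _ _] := Hf (n, s n) (ins n).
  by apply: (le_trans ih); rewrite exprSr -mulrA ler_pM2l // exprn_gt0.
have mono n m : [/\ (s n).1 <= (s (n + m)%N).1, (s (n + m)%N).1 + L (n + m)%N <= (s n).1 + L n,
   (s n).2 <= (s (n + m)%N).2 & (s (n + m)%N).2 + M (n + m)%N <= (s n).2 + M n].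
  elim: m => [|m [i1 i2 i3 i4]]; first by rewrite addn0; split.
  rewrite addnS; have [_ _ /= j1 j2] := Hf (_, s _) (ins (n + m)%N).
  rewrite -[f _]/(s (n + m)%N.+1) in j1 j2.
  by split; lra.
have cross n m : (s m).1 <= (s n).1 + L n /\ (s m).2 <= (s n).2 + M n.
  have [e1 e2 e3 e4] := mono m n; have := mono n m; rewrite addnC => -[f1 f2 f3 f4].
  have := Lge0 (m + n)%N; have := Mge0 (m + n)%N; lra.
(* By [cross] every left end lies below every right end, so the supremum of the left ends belongs to
   all the intervals; likewise for [y]. *)
have [x Hx] : exists x, forall n, (s n).1 <= x <= (s n).1 + L n.
  exists (sup (range (fun n => (s n).1))) => n; apply/andP; split.
    apply: ub_le_sup; last by exists n.
    by exists ((s 0%N).1 + L 0) => _ [m _ <-]; have [] := cross 0%N m.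
  apply: ge_sup; first by exists ((s 0%N).1); exists 0%N.
  by move=> _ [m _ <-]; have [] := cross n m.
have [y Hy] : exists y, forall n, (s n).2 <= y <= (s n).2 + M n.
  exists (sup (range (fun n => (s n).2))) => n; apply/andP; split.
    apply: ub_le_sup; last by exists n.
    by exists ((s 0%N).2 + M 0) => _ [m _ <-]; have [] := cross 0%N m.
  apply: ge_sup; first by exists ((s 0%N).2); exists 0%N.
  by move=> _ [m _ <-]; have [] := cross n m.
have xab : a <= x <= b.
  have := Hx 0%N; rewrite /= /L expr0 divr1; lra.
have ycd : c <= y <= d.
  have := Hy 0%N; rewrite /= /M expr0 divr1; lra.
apply/eqP; rewrite -normr_eq0 eq_le normr_ge0 andbT.
apply/ler_addgt0Pl => e e0; rewrite addr0.
pose t := (b - a) + (d - c).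
have t0 : 0 <= t by rewrite /t; lra.
(* The quadratic bound sums up to [t ^+ 2] times the local constant; [1 + t] replaces [t] because
   the rectangle may be degenerate. *)
have e0' : 0 < e / (1 + t) ^+ 2 by rewrite divr_gt0 // exprn_gt0 // ltr_wpDr.
have [del del0 H] := local xab ycd e0'.
have [N HN] := @geometric_lt R 2^-1 (del / 2) t (ltac:(by rewrite invr_ge0))
  (ltac:(by rewrite invf_lt1 // ltr1n)) (ltac:(by rewrite divr_gt0)).
have {HN} := HN N (leqnn _); rewrite exprVn => tN.
apply: (le_trans (large N)).
have [i1 i2 i3 i4] := ins N.
have p0 : 0 < (2 : R) ^+ N by rewrite exprn_gt0.
have LM : L N + M N = t / 2 ^+ N by rewrite /L /M -mulrDl.
have : `|sq N (s N)| <= e / (1 + t) ^+ 2 * (t / 2 ^+ N) ^+ 2.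
  rewrite -LM /sq; have := H (s N).1 ((s N).1 + L N) (s N).2 ((s N).2 + M N).
  have -> : (s N).1 + L N - (s N).1 = L N by ring.
  have -> : (s N).2 + M N - (s N).2 = M N by ring.
  have := Lge0 N; have := Mge0 N.
  by move=> ? ?; apply => //; lra.
rewrite -(ler_pM2l (_ : 0 < 4 ^+ N)) ?exprn_gt0 // => /le_trans; apply.
have -> : (4 : R) = 2 ^+ 2 by rewrite expr2 -natrM.
have -> : (2 ^+ 2) ^+ N * (e / (1 + t) ^+ 2 * (t / 2 ^+ N) ^+ 2) = e * (t / (1 + t)) ^+ 2 :> R.
  by rewrite -exprM mulnC exprM; field; rewrite !gt_eqF // ltr_wpDr.
rewrite -[X in _ <= X]mulr1 ler_pM2l // exprn_ile1 ?divr_ge0 //; first lra.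
by rewrite ler_pdivrMr ?ltr_wpDr // mul1r lerDr.
Qed.

End Bisection.

Section Goursat.
Variable R : realType.
Implicit Types (H : R[i]^o -> R[i]^o).

Lemma contseg_eps (a b : R) f :
  (forall x, a <= x <= b -> forall e, 0 < e -> exists2 del, 0 < del &
     forall x', `|x' - x| < del -> `|f x' - f x| <= e) -> contseg a b f.
Proof.
move=> h; apply: continuous_in_subspaceT => x; rewrite inE /= in_itv /= => xab.
apply/cvgrPdist_le => e e0; have [del del0 H] := h x xab e e0.
by near do (rewrite distrC H // distrC); apply: cvgr_dist_lt.
Unshelve. all: by end_near. Qed.

Lemma cnorm_Complex_le (x y x' y' : R) :
  cnorm ((x' +i* y')%C - (x +i* y)%C : R[i]) <= `|x' - x| + `|y' - y|.
Proof. by rewrite (le_trans (cnorm_le _)). Qed.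

(** Only the imaginary part of the boundary integral of [H] is used below. It involves the real part
    of [H] on vertical sides and the imaginary part on horizontal ones. *)
Lemma continuous_vert H (x c d : R) :
  (forall y, c <= y <= d -> exists D, has_cderiv H (x +i* y)%C D) ->
  contseg c d (fun y => Re (H (x +i* y)%C)).
Proof.
move=> h; apply: contseg_eps => y yc e e0.
have [D /cderiv_continuous/(_ e e0)[del del0 hD]] := h y yc.
exists del => // y' yy; have /hD : cnorm ((x +i* y')%C - (x +i* y)%C : R[i]) < del.
  by rewrite (le_lt_trans (cnorm_Complex_le _ _ _ _)) // subrr normr0 add0r.
by apply: le_trans; rewrite -raddfB normRe_le.
Qed.

Lemma continuous_horiz H (y a b : R) :
  (forall x, a <= x <= b -> exists D, has_cderiv H (x +i* y)%C D) ->
  contseg a b (fun x => Im (H (x +i* y)%C)).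
Proof.
move=> h; apply: contseg_eps => x xa e e0.
have [D /cderiv_continuous/(_ e e0)[del del0 hD]] := h x xa.
exists del => // x' xx; have /hD : cnorm ((x' +i* y)%C - (x +i* y)%C : R[i]) < del.
  by rewrite (le_lt_trans (cnorm_Complex_le _ _ _ _)) // subrr normr0 addr0.
by apply: le_trans; rewrite -raddfB normIm_le.
Qed.

(* An affine function has zero boundary integral, so on a small rectangle only the
   remainder of the first-order expansion counts. *)
Lemma goursat H a b c d : a <= b -> c <= d ->
  (forall x y, a <= x <= b -> c <= y <= d -> exists D, has_cderiv H (x +i* y)%C D) ->
  segint c d (fun y => Re (H (b +i* y)%C) - Re (H (a +i* y)%C)) =
  segint a b (fun x => Im (H (x +i* d)%C) - Im (H (x +i* c)%C)).
Proof.
move=> ab cd dH.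
pose Phi a b c d := segint c d (fun y => Re (H (b +i* y)%C) - Re (H (a +i* y)%C)) -
  segint a b (fun x => Im (H (x +i* d)%C) - Im (H (x +i* c)%C)).
have cv x c' d' : a <= x <= b -> c <= c' -> d' <= d ->
    contseg c' d' (fun y => Re (H (x +i* y)%C)).
  by move=> xab h1 h2; apply: continuous_vert => y hy; apply: dH => //; lra.
have ch y a' b' : c <= y <= d -> a <= a' -> b' <= b ->
    contseg a' b' (fun x => Im (H (x +i* y)%C)).
  by move=> xab h1 h2; apply: continuous_horiz => x hx; apply: dH => //; lra.
apply/eqP; rewrite -subr_eq0; apply/eqP; apply: (@bisection_eq0 _ Phi a b c d) => //.
- move=> a' b' c' d' m h1 h2 h3 h4 h5 h6 h7; rewrite /Phi.
  rewrite (@segint_split _ a' b' m) //; last first.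
    by apply: contsegB; apply: ch => //; lra.
  rewrite !segintB; try (apply: cv => //; lra); try (apply: ch => //; lra).
  ring.
- move=> a' b' c' d' m h1 h2 h3 h4 h5 h6 h7; rewrite /Phi.
  rewrite (@segint_split _ c' d' m) //; last first.
    by apply: contsegB; apply: cv => //; lra.
  rewrite !segintB; try (apply: cv => //; lra); try (apply: ch => //; lra).
  ring.
- move=> x y xab ycd e e0; have [D /(_ (e / 2)) hD] := dH _ _ xab ycd.
  have [|del del0 {}hD] := hD; first by rewrite divr_gt0.
  (* A point of the small rectangle is at distance at most the sum of the two sides from [(x, y)],
     hence less than [del]. *)
  exists (del / 2); first by rewrite divr_gt0.
  move=> a' b' c' d' h1 /andP[h2 h3] h4 h5 /andP[h6 h7] h8 h9 h10.
  pose E (w : R[i]) : R[i] := H w - H (x +i* y)%C - (w - (x +i* y)%C) * D.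
  pose S := (b' - a') + (d' - c').
  have Esmall x' y' : a' <= x' <= b' -> c' <= y' <= d' ->
      cnorm (E (x' +i* y')%C) <= e / 2 * S.
    move=> /andP[i1 i2] /andP[i3 i4].
    have nS : cnorm ((x' +i* y')%C - (x +i* y)%C : R[i]) <= S.
      apply: (le_trans (cnorm_Complex_le _ _ _ _)).
      by rewrite lerD // ler_norml; apply/andP; split; lra.
    have /hD /le_trans : cnorm ((x' +i* y')%C - (x +i* y)%C : R[i]) < del.
      by rewrite (le_lt_trans nS) // /S; lra.
    by apply; rewrite ler_pM2l // divr_gt0.
  (* The affine part contributes the constants [(b' - a') * Re D] and [(d' - c') * Re D]; their
     integrals over the other side agree, so both may be subtracted. *)
  have ReE y' : Re (H (b' +i* y')%C) - Re (H (a' +i* y')%C) - (b' - a') * Re D =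
      Re (E (b' +i* y')%C) - Re (E (a' +i* y')%C).
    rewrite /E; case: D {hD E Esmall} => al be; rewrite !raddfB /=; ring.
  have ImE x' : Im (H (x' +i* d')%C) - Im (H (x' +i* c')%C) - (d' - c') * Re D =
      Im (E (x' +i* d')%C) - Im (E (x' +i* c')%C).
    rewrite /E; case: D {hD E Esmall ReE} => al be; rewrite !raddfB /=; ring.
  have i1 : `|segint c' d' (fun y => Re (H (b' +i* y)%C) - Re (H (a' +i* y)%C)
      - (b' - a') * Re D)| <= e * S * (d' - c').
    apply: segint_le; first lra.
      by apply: contsegB; [apply: contsegB; apply: cv => //; lra|exact: contseg_cst].
    move=> y' hy; rewrite ReE; apply: (le_trans (ler_normB _ _)).
    have -> : e * S = e / 2 * S + e / 2 * S by field.
    by rewrite lerD // (le_trans (normRe_le _)) // Esmall //; lra.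
  have i2 : `|segint a' b' (fun x => Im (H (x +i* d')%C) - Im (H (x +i* c')%C)
      - (d' - c') * Re D)| <= e * S * (b' - a').
    apply: segint_le; first lra.
      by apply: contsegB; [apply: contsegB; apply: ch => //; lra|exact: contseg_cst].
    move=> x' hx; rewrite ImE; apply: (le_trans (ler_normB _ _)).
    have -> : e * S = e / 2 * S + e / 2 * S by field.
    by rewrite lerD // (le_trans (normIm_le _)) // Esmall //; lra.
  have -> : Phi a' b' c' d' =
    segint c' d' (fun y => Re (H (b' +i* y)%C) - Re (H (a' +i* y)%C) - (b' - a') * Re D)
    - segint a' b' (fun x => Im (H (x +i* d')%C) - Im (H (x +i* c')%C) - (d' - c') * Re D).
    have cvb : contseg c' d' (fun y => Re (H (b' +i* y)%C) - Re (H (a' +i* y)%C)).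
      by apply: contsegB; apply: cv => //; lra.
    have cha : contseg a' b' (fun x => Im (H (x +i* d')%C) - Im (H (x +i* c')%C)).
      by apply: contsegB; apply: ch => //; lra.
    have ccst := @contseg_cst R.
    rewrite /Phi (segintB cvb (ccst _ _ _)) (segintB cha (ccst _ _ _)).
    by rewrite !segint_cst; [ring|lra|lra].
  apply: (le_trans (ler_normB _ _)); apply: (le_trans (lerD i1 i2)).
  rewrite -/S le_eqVlt; apply/orP; left; apply/eqP; rewrite /S; ring.
Qed.

End Goursat.

(** * Means over circles *)

Lemma is_derive_eps (R : realType) (f : R -> R) (x d : R) : is_derive x 1 f d ->
  forall e, 0 < e -> exists2 del, 0 < del & forall h, `|h| < del ->
    `|f (x + h) - f x - h * d| <= e * `|h|.
Proof.
move=> [/cvg_ex[l fl] fd] e e0.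
have {fd}ld : l = d by rewrite -fd; apply/esym/cvg_lim.
subst l; move/cvgrPdist_le : fl => /(_ e e0).
rewrite -nbhs_nearE => /nbhs_ballP[del /= del0 H].
exists del => // h hd; have [->|h0] := eqVneq h 0.
  by rewrite addr0 subrr mul0r subr0 normr0 mulr0.
have := H h; rewrite -ball_normE /= sub0r normrN => /(_ hd h0).
rewrite -[h%:A]/(h * 1) mulr1 [h + x]addrC distrC => H1.
have -> : f (x + h) - f x - h * d = h * (h^-1 *: (f (x + h) - f x) - d).
  by rewrite mulrBr -[_ *: _]/(h^-1 * _) mulVKf.
by rewrite normrM mulrC ler_wpM2r.
Qed.

Section Chain.
Variables (R : realType) (V : normedModType R[i]).

Lemma has_cderiv_comp (g : R[i]^o -> R[i]^o) (f : R[i]^o -> V) z (d : R[i]) D :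
  has_cderiv g z d -> has_cderiv f (g z) D ->
  has_cderiv (fun w => f (g w)) z (d *: D).
Proof.
move=> gd fD e e0.
have d1 : 0 < cnorm d + 1 by rewrite ltr_wpDl ?rnorm_ge0.
have D1 : 0 < rnorm D + 1 by rewrite ltr_wpDl ?rnorm_ge0.
(* [e1] controls the remainder of [f] and [e2] that of [g]. The cap [e2 <= 1] gives the Lipschitz
   constant [cnorm d + 1] for [g] at [z]. *)
pose e1 := e / 2 / (cnorm d + 1); pose e2 := Num.min 1 (e / 2 / (rnorm D + 1)).
have e10 : 0 < e1 by rewrite !divr_gt0.
have e20 : 0 < e2 by rewrite lt_min ltr01 !divr_gt0.
have [del1 del10 H1] := fD _ e10; have [del2 del20 H2] := gd _ e20.
have [del3 del30 H3] := cderiv_continuous gd (divr_gt0 del10 (@ltr0Sn _ 1)).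
exists (Num.min del2 del3); first by rewrite lt_min del20.
move=> w; rewrite lt_min => /andP[/H2 {}H2 /H3 {}H3].
have n0 := rnorm_ge0 ((w - z : R[i]) : R[i]^o).
have e21 : e2 <= 1 by rewrite ge_min lexx.
have e2e : e2 * rnorm D <= e / 2.
  apply: (@le_trans _ _ (e / 2 / (rnorm D + 1) * rnorm D)).
    by rewrite ler_wpM2r ?rnorm_ge0 // ge_min lexx orbT.
  rewrite -mulrA -[X in _ <= X]mulr1 ler_pM2l ?divr_gt0 // mulrC ler_pdivrMr //.
  by rewrite mul1r lerDl.
have gw : cnorm (g w - g z) <= (cnorm d + 1) * cnorm (w - z).
  rewrite -[g w - g z](subrK ((w - z) * d)) [X in _ <= X]mulrDl mul1r.
  apply: (le_trans (rnormD _ _)); rewrite addrC lerD //.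
    by rewrite cnormM mulrC.
  by apply: (le_trans H2); rewrite ler_piMl.
have -> : f (g w) - f (g z) - (w - z) *: (d *: D) =
   (f (g w) - f (g z) - (g w - g z) *: D) + (g w - g z - (w - z) *: (d : R[i]^o)) *: D.
  by rewrite [X in _ = _ + X]scalerBl addrA subrK scalerA.
apply: (le_trans (rnormD _ _)).
have -> : e * cnorm (w - z) = e / 2 * cnorm (w - z) + e / 2 * cnorm (w - z).
  by field.
rewrite lerD //.
  apply: (le_trans (H1 _ _)).
    by rewrite (le_lt_trans H3) // ltr_pdivrMr // ltr_pMr // ltr1n.
  apply: (@le_trans _ _ (e1 * ((cnorm d + 1) * cnorm (w - z)))).
    by rewrite ler_pM2l.
  by rewrite mulrA /e1 divfK // gt_eqF.
rewrite rnormZ; apply: (@le_trans _ _ (e2 * cnorm (w - z) * rnorm D)).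
  by rewrite ler_wpM2r ?rnorm_ge0.
by rewrite mulrAC ler_wpM2r.
Qed.

End Chain.

Section ComplexExp.
Variable R : realType.

Definition circ (r t : R) : R[i] := ((r * cos t) +i* (r * sin t))%C.

(** The exponential in polar form, so that [circ r t] is [cexp (ln r +i* t)] for positive [r] and
    circles become vertical segments. *)
Definition cexp (w : R[i]) : R[i] := circ (expR (Re w)) (Im w).

Lemma cnorm_circ r t : 0 <= r -> cnorm (circ r t) = r.
Proof.
move=> r0; rewrite cnormE /= !exprMn -mulrDr cos2Dsin2 mulr1 sqrtr_sqr.
by rewrite ger0_norm.
Qed.

Lemma cexpD (w k : R[i]) : cexp (w + k) = cexp w * cexp k.
Proof.
case: w => a b; case: k => c d; rewrite /cexp /circ /= expRD cosD sinD.
by apply/eqP; rewrite eq_complex /=; apply/andP; split; apply/eqP; ring.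
Qed.

(** The functional equation reduces the claim to the expansion at [0], which follows from the real
    expansions of [expR], [sin] and [cos]. *)
Lemma cexp_has_cderiv (z : R[i]) : has_cderiv (cexp : R[i]^o -> R[i]^o) z (cexp z).
Proof.
suff H : forall e : R, 0 < e -> exists2 del : R, 0 < del &
    forall k : R[i], cnorm k < del -> cnorm (cexp k - 1 - k) <= e * cnorm k.
  move=> e e0; have z1 : 0 < 1 + cnorm (cexp z) by rewrite ltr_wpDr ?rnorm_ge0.
  have [del del0 h] := H _ (divr_gt0 e0 z1); exists del => // w /h {}h.
  rewrite -[in cexp w](subrK z w) cexpD.
  have -> : cexp (w - z) * cexp z - cexp z - (w - z) *: (cexp z : R[i]^o) =
    (cexp (w - z) - 1 - (w - z)) * cexp z by rewrite -[_ *: _]/(_ * _); ring.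
  rewrite cnormM.
  apply: (@le_trans _ _ (e / (1 + cnorm (cexp z)) * cnorm (w - z) * cnorm (cexp z))).
    by rewrite ler_wpM2r ?rnorm_ge0.
  rewrite mulrAC ler_wpM2r ?rnorm_ge0 // -mulrA -[X in _ <= X]mulr1 ler_pM2l //.
  by rewrite mulrC ler_pdivrMr // mul1r lerDr.
(* The five error terms below cost seven times [e / 8 * cnorm k] in total, since [1 + x] counts
   double; the cap by [1] ensures [1 + x] is at most [2]. *)
move=> e e0; pose e1 := Num.min 1 (e / 8).
have e10 : 0 < e1 by rewrite lt_min ltr01 divr_gt0.
have e11 : e1 <= 1 by rewrite ge_min lexx.
have e1e : e1 <= e / 8 by rewrite ge_min lexx orbT.
clearbody e1.
have [de de0 He] := is_derive_eps (is_derive_expR (0 : R)) e10.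
have [ds ds0 Hs] := is_derive_eps (is_derive_sin (0 : R)) e10.
have [dc dc0 Hc] := is_derive_eps (is_derive_cos (0 : R)) e10.
exists (Num.min e1 (Num.min de (Num.min ds dc))).
  by rewrite !lt_min e10 de0 ds0.
case=> x y; rewrite !lt_min => /and4P[k1 ke ks kc].
have nx : `|x| <= cnorm (x +i* y)%C by exact: (normRe_le (x +i* y)%C).
have ny : `|y| <= cnorm (x +i* y)%C by exact: (normIm_le (x +i* y)%C).
have {He}He := He x (le_lt_trans nx ke).
have {Hs}Hs := Hs y (le_lt_trans ny ks).
have {Hc}Hc := Hc y (le_lt_trans ny kc).
rewrite !add0r expR0 mulr1 in He.
rewrite !add0r sin0 cos0 subr0 mulr1 in Hs.
rewrite !add0r cos0 sin0 oppr0 mulr0 subr0 in Hc.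
set k := (x +i* y)%C in k1 nx ny *.
have k0 : 0 <= cnorm k by exact: rnorm_ge0.
have y1 : `|y| <= e1 by rewrite (le_trans ny) // ltW.
have x1 : `|x| <= 1 by rewrite (le_trans nx) // (le_trans (ltW k1)).
have xe : `|x| <= e1 by rewrite (le_trans nx) // ltW.
have cosle : `|cos y| <= 1 by rewrite ler_norml cos_geN1 cos_le1.
have ek : forall t, t <= cnorm k -> e1 * t <= e / 8 * cnorm k.
  move=> t tk; apply: (@le_trans _ _ (e1 * cnorm k)); first by rewrite ler_pM2l.
  by rewrite ler_wpM2r.
apply: (le_trans (cnorm_le _)).
have -> : Re (cexp k - 1 - k) = (expR x - 1 - x) * cos y + (1 + x) * (cos y - 1).
  by rewrite /cexp /circ /=; ring.
have -> : Im (cexp k - 1 - k) = (expR x - 1 - x) * sin y + (1 + x) * (sin y - y) + x * y.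
  by rewrite /cexp /circ /=; ring.
have sinle : `|sin y| <= 1 by rewrite ler_norml sin_geN1 sin_le1.
have b1 : `|(expR x - 1 - x) * cos y| <= e / 8 * cnorm k.
  rewrite normrM (le_trans _ (ek _ nx)) // (le_trans _ He) // ler_piMr //.
have b2 : `|(expR x - 1 - x) * sin y| <= e / 8 * cnorm k.
  rewrite normrM (le_trans _ (ek _ nx)) // (le_trans _ He) // ler_piMr //.
have x2 : `|1 + x| <= 2.
  by rewrite (le_trans (ler_normD _ _)) // normr1; lra.
have b3 : `|(1 + x) * (cos y - 1)| <= 2 * (e / 8 * cnorm k).
  by rewrite normrM ler_pM // (le_trans Hc) // ek.
have b4 : `|(1 + x) * (sin y - y)| <= 2 * (e / 8 * cnorm k).
  by rewrite normrM ler_pM // (le_trans Hs) // ek.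
have b5 : `|x * y| <= e / 8 * cnorm k.
  by rewrite normrM (le_trans _ (ek _ ny)) // ler_wpM2r.
have t1 := ler_normD ((expR x - 1 - x) * cos y) ((1 + x) * (cos y - 1)).
have t2 := ler_normD ((expR x - 1 - x) * sin y + (1 + x) * (sin y - y)) (x * y).
have t3 := ler_normD ((expR x - 1 - x) * sin y) ((1 + x) * (sin y - y)).
have -> : e * cnorm k = 8 * (e / 8 * cnorm k) by field.
have := mulr_ge0 (ltW (divr_gt0 e0 (ltr0Sn R 7))) k0.
lra.
Qed.

End ComplexExp.

Section CircleMean.
Variable R : realType.
Implicit Types (h p q : R[i]^o -> R[i]^o) (r s : R).

(** This is [2 * pi] times the real part of the mean over the circle, or the real part of the
    integral of [h z / (i z)]. Imaginary parts are reached by multiplying by ['i]. *)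
Definition circint h r : R := segint 0 (2 * pi) (fun t => Re (h (circ r t))).

Let pi2_ge0 : 0 <= 2 * pi :> R.
Proof. by rewrite mulr_ge0 // pi_ge0. Qed.

Let pi2_gt0 : 0 < 2 * pi :> R.
Proof. by rewrite mulr_gt0 // pi_gt0. Qed.

Lemma cderiv_cexp_comp h (w : R[i]) : derivable h (cexp w) 1 ->
  exists D, has_cderiv (fun z => h (cexp z)) w D.
Proof.
move=> /derivable_cderiv[D hD]; exists (cexp w *: D).
exact: (has_cderiv_comp (cexp_has_cderiv w) hD).
Qed.

Lemma cnorm_cexp (w : R[i]) : cnorm (cexp w) = expR (Re w).
Proof. by rewrite cnorm_circ // expR_ge0. Qed.

Lemma contseg_circ h r : 0 < r ->
  (forall z, cnorm z = r -> derivable h z 1) ->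
  contseg 0 (2 * pi) (fun t => Re (h (circ r t))).
Proof.
move=> r0 hr.
have -> : (fun t => Re (h (circ r t))) =
    (fun t => Re ((fun z => h (cexp z)) (ln r +i* t)%C)).
  by apply/funext => t; rewrite /cexp /= lnK.
apply: (@continuous_vert R (fun z => h (cexp z)) (ln r)) => t _; apply: cderiv_cexp_comp; apply: hr.
by rewrite cnorm_cexp /= lnK.
Qed.

(* In the coordinate [z = exp w] the horizontal sides cancel by periodicity. *)
Lemma circint_radius h r s : 0 < r -> r <= s ->
  (forall z, r <= cnorm z <= s -> derivable h z 1) ->
  circint h r = circint h s.
Proof.
move=> r0 rs hrs; have s0 := lt_le_trans r0 rs.
apply/eqP; rewrite eq_sym -subr_eq0 /circint -segintB; last 2 first.
- by apply: contseg_circ => // z zs; apply: hrs; rewrite zs rs lexx.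
- by apply: contseg_circ => // z zs; apply: hrs; rewrite zs rs lexx.
have := @goursat R (fun z => h (cexp z)) (ln r) (ln s) 0 (2 * pi).
rewrite ler_ln // => /(_ rs pi2_ge0).
rewrite /cexp /= !lnK // => ->; last first.
  move=> x y /andP[rx xs] _; apply: cderiv_cexp_comp; apply: hrs.
  rewrite cnorm_cexp /= -[r](lnK r0) -[s](lnK s0) !ler_expR.
  by rewrite rx xs.
rewrite (@eq_segint _ _ _ _ (fun=> 0)); last first.
  move=> x _; rewrite /circ.
  by rewrite [2 * pi]mulr_natl cos2pi sin2pi cos0 sin0 subrr.
by rewrite segint_cst ?ler_ln // mul0r.
Qed.

Lemma circintB h q r : 0 < r ->
  (forall z, cnorm z = r -> derivable h z 1) ->
  (forall z, cnorm z = r -> derivable q z 1) ->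
  circint (fun z => h z - q z) r = circint h r - circint q r.
Proof.
move=> r0 hh hq.
rewrite /circint -(segintB (contseg_circ r0 hh) (contseg_circ r0 hq)).
by apply: eq_segint => x _; rewrite raddfB.
Qed.

Lemma circint_cst (k : R[i]) r : circint (fun=> k) r = Re k * (2 * pi).
Proof. by rewrite /circint segint_cst // subr0. Qed.

Lemma circint_le h r k : 0 < r ->
  (forall z, cnorm z = r -> derivable h z 1) ->
  (forall t, 0 <= t <= 2 * pi -> cnorm (h (circ r t)) <= k) ->
  `|circint h r| <= k * (2 * pi).
Proof.
move=> r0 hh hk; rewrite -[X in k * X]subr0; apply: segint_le => //.
  exact: contseg_circ.
by move=> t /hk; apply: le_trans (normRe_le _).
Qed.

(** The circle can be shrunk without changing the integral, and on small circles [p] is close to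
    [p 0 = 0]. *)
Lemma circint_eq0 p r : 0 < r -> p 0 = 0 ->
  (forall z, cnorm z <= r -> derivable p z 1) -> circint p r = 0.
Proof.
move=> r0 p0 hp; apply/eqP; rewrite -normr_eq0 eq_le normr_ge0 andbT.
apply/ler_addgt0Pl => e e0; rewrite addr0.
have [D hD] : exists D, has_cderiv p 0 D.
  by apply/derivable_cderiv/hp; rewrite rnorm0 ltW.
have [del del0 H] := cderiv_continuous hD (divr_gt0 e0 pi2_gt0).
pose s := Num.min r (del / 2).
have s0 : 0 < s by rewrite lt_min r0 divr_gt0.
have sr : s <= r by rewrite ge_min lexx.
have sd : s < del.
  by rewrite gt_min; apply/orP; right; rewrite ltr_pdivrMr // ltr_pMr // ltr1n.
rewrite -(@circint_radius p s r) //; last by move=> z /andP[_ /hp].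
rewrite -[e](@divfK _ (2 * pi)) ?gt_eqF //; apply: circint_le => //.
  by move=> z zs; apply: hp; rewrite zs.
move=> t _; have := H (circ s t); rewrite p0 !subr0; apply.
by rewrite (cnorm_circ _ (ltW s0)).
Qed.

(** Here [c] is the constant Laurent coefficient of [h] at infinity, and [q] the part growing there.
    The mean of [q] vanishes and that of [h - q - c] is small on large circles, so the mean of [h]
    over the circle of radius [s] has real part [Re c]. *)
Lemma cauchy_estimate h q (c : R[i]) s k : 0 < s ->
  (forall z, s <= cnorm z -> derivable h z 1) ->
  (forall z, derivable q z 1) -> q 0 = 0 ->
  (forall e, 0 < e -> exists r, forall z, r <= cnorm z -> cnorm (h z - q z - c) <= e) ->
  (forall t, 0 <= t <= 2 * pi -> cnorm (h (circ s t)) <= k) -> `|Re c| <= k.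
Proof.
move=> s0 hh hq q0 hc hk; apply/ler_addgt0Pl => e e0.
have [r hr] := hc _ e0; pose t := Num.max r s.
have st : s <= t by rewrite le_max lexx orbT.
have t0 : 0 < t by rewrite (lt_le_trans s0).
have dhq z : s <= cnorm z -> derivable (fun z => h z - q z) z 1.
  by move=> sz; apply: derivableB; [exact: hh|exact: hq].
have E : circint (fun z => h z - q z) t = circint h s.
  rewrite -(@circint_radius _ s t) //; last by move=> z /andP[+ _]; exact: dhq.
  rewrite circintB //; last by move=> z zs; apply: hh; rewrite zs.
  by rewrite (@circint_eq0 q) // subr0.
have E2 : circint (fun z => h z - q z - c) t = circint h s - Re c * (2 * pi).
  rewrite circintB //.
  - by rewrite E circint_cst.
  - by move=> z zt; apply: dhq; rewrite zt.
have b1 : `|circint h s| <= k * (2 * pi).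
  by apply: circint_le => // z zs; apply: hh; rewrite zs.
have b2 : `|circint (fun z => h z - q z - c) t| <= e * (2 * pi).
  apply: circint_le => // [z zt|a _].
    by apply: derivableB; [apply: dhq; rewrite zt|exact: derivable_cst].
  by apply: hr; rewrite (cnorm_circ _ (ltW t0)) le_max lexx.
rewrite -(ler_pM2r pi2_gt0) -[X in `|_| * X]ger0_norm // -normrM [(e + k) * _]mulrDl.

have -> : Re c * (2 * pi) = circint h s - circint (fun z => h z - q z - c) t.
  by rewrite E2 opprB addrCA subrr addr0.
by rewrite [X in _ <= X]addrC (le_trans (ler_normB _ _)) // lerD.
Qed.

(** The mean over a large circle is small and has the real part of the value at the centre.
    Multiplication by ['i] treats the imaginary part, and a translation the other points. *)
Lemma liouville h : (forall z, derivable h z 1) ->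
  (forall e, 0 < e -> exists r, forall z, r <= cnorm z -> cnorm (h z) <= e) ->
  forall z, h z = 0.
Proof.
move=> dh h0 z.
have Re0 (g : R[i]^o -> R[i]^o) : (forall z, derivable g z 1) ->
    (forall e, 0 < e -> exists r, forall z, r <= cnorm z -> cnorm (g z) <= e) ->
    Re (g 0) = 0.
  move=> dg g0; apply/eqP; rewrite -normr_eq0 eq_le normr_ge0 andbT.
  apply/ler_addgt0Pl => e e0; rewrite addr0.
  have [r gr] := g0 _ e0; pose t := Num.max r 1.
  have t0 : 0 < t by rewrite lt_max ltr01 orbT.
  have tr : r <= t by rewrite le_max lexx.
  have : circint (fun z => g z - g 0) t = 0.
    apply: circint_eq0 => //; first by rewrite subrr.
    by move=> w _; apply: derivableB => //; exact: derivable_cst.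
  rewrite circintB //.
  move/eqP; rewrite circint_cst subr_eq0 => /eqP E.
  rewrite -(ler_pM2r pi2_gt0) -[X in `|_| * X]ger0_norm // -normrM -E.
  by apply: circint_le => // a _; apply: gr; rewrite (cnorm_circ _ (ltW t0)).
have Re0' (g : R[i]^o -> R[i]^o) : (forall z, derivable g z 1) ->
    (forall e, 0 < e -> exists r, forall z, r <= cnorm z -> cnorm (g z) <= e) ->
    g 0 = 0.
  move=> dg g0; apply/eqP; rewrite eq_complex Re0 // eqxx /=.
  suff : Re ('i%C * g 0) = 0 by rewrite mulrC ReiNIm => /eqP; rewrite oppr_eq0.
  apply: (Re0 (fun z => 'i%C * g z)) => [w|e e0].
    by apply: derivableM => //; exact: derivable_cst.
  have [r gr] := g0 _ e0; exists r => w /gr; rewrite cnormM.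
  suff -> : cnorm ('i%C : R[i]) = 1 by rewrite mul1r.
  by rewrite cnormE /= expr0n expr1n add0r sqrtr1.
have := Re0' (fun w => h (w + z)); rewrite add0r; apply.
  move=> w; apply/derivable_cderiv; have /derivable_cderiv[D hD] := dh (w + z).
  exists D => e /hD[del del0 H]; exists del => // w' ww.
  by have := H (w' + z); rewrite opprD addrACA subrr addr0; exact.
move=> e e0; have [r hr] := h0 _ e0; exists (r + cnorm z) => w rw; apply: hr.
rewrite -(lerD2r (cnorm z)) (le_trans rw) //.
by rewrite -{1}[w](addrK z) rnormB.
Qed.

End CircleMean.

(** * Resolvents on invariant subspaces *)

Section Subspaces.
Variables (R : realType) (V : normedModType R[i]).
Implicit Types (M : set V) (x y : V) (a : R[i]).

(** Closedness is left out so that [solution_cderiv] also applies to the spaces [orbit_space]. *)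
Definition lin_subspace M := M 0 /\ forall a x y, M x -> M y -> M (a *: x + y).

Lemma lin_subspaceT : lin_subspace setT. Proof. by []. Qed.

Lemma closed_lin_subspace M : closed_subspace M -> lin_subspace M.
Proof. by case. Qed.

Lemma closed_subspace_setT : closed_subspace (setT : set V).
Proof. by split=> //; exact: closedT. Qed.

Variables (M : set V) (subM : lin_subspace M).

Lemma subspaceZ a x : M x -> M (a *: x).
Proof. by case: subM => M0 ML Mx; rewrite -[a *: x]addr0; exact: ML. Qed.

Lemma subspaceD x y : M x -> M y -> M (x + y).
Proof. by case: subM => M0 ML Mx My; rewrite -[x]scale1r; exact: ML. Qed.

Lemma subspaceB x y : M x -> M y -> M (x - y).
Proof. by move=> Mx My; rewrite -[- y]scaleN1r; apply/subspaceD/subspaceZ. Qed.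

Lemma continuous_subspace_bounded (S : V -> V) :
  (forall a x y, M x -> M y -> S (a *: x + y) = a *: S x + S y) ->
  {within M, continuous S} ->
  exists2 K : R, 0 <= K & forall x, M x -> rnorm (S x) <= K * rnorm x.
Proof.
case: subM => M0 ML Slin /subspace_continuousP/(_ 0 M0) S0c.
have S0 : S 0 = 0.
  apply: (@addrI _ (S 0)); rewrite addr0.
  by have := Slin 1 0 0 M0 M0; rewrite scale1r addr0 scale1r => <-.
have SZ a x : M x -> S (a *: x) = a *: S x.
  by move=> Mx; have := Slin a x 0 Mx M0; rewrite !addr0 S0 addr0.
have {}S0c : S @ within M (nbhs 0) --> (0 : V) by rewrite -[X in _ --> X]S0.
move/cvgrPdist_le : S0c => /(_ 1 ltr01).
rewrite near_withinE -nbhs_nearE => /nbhs_rnormP[del del0 H].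
exists (2 / del) => [|x Mx]; first by rewrite divr_ge0 // ltW.
have [->|x0] := eqVneq x 0; first by rewrite S0 rnorm0 mulr0.
have nx : 0 < rnorm x by rewrite rnorm_gt0.
(* Rescales [x] to norm [del / 2], where continuity at [0] bounds the image by [1]. *)
pose c := del / (2 * rnorm x).
have c0 : 0 < c by rewrite divr_gt0 // mulr_gt0.
have nc : cnorm (c%:C%C : R[i]) = c by rewrite cnormr gtr0_norm.
have : rnorm (c%:C%C *: x - 0) < del.
  rewrite subr0 rnormZ nc /c; have -> : del / (2 * rnorm x) * rnorm x = del / 2.
    by field; rewrite gt_eqF.
  by rewrite ltr_pdivrMr // ltr_pMr // ltr1n.
move=> /H /(_ (subspaceZ _ Mx)); rewrite sub0r normrN SZ // rnormE -(rmorph1 (real_complex R)) lecR.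
rewrite rnormZ nc -ler_pdivlMl // mulr1 => /le_trans; apply.
by rewrite le_eqVlt; apply/orP; left; apply/eqP; rewrite /c; field; rewrite !gt_eqF.
Qed.

Lemma bounded_subspace_continuous (S : V -> V) (K : R) :
  (forall x y, M x -> M y -> S (x - y) = S x - S y) ->
  (forall x, M x -> rnorm (S x) <= K * rnorm x) -> {within M, continuous S}.
Proof.
move=> SB SK; apply/subspace_continuousP => x Mx; apply/cvgrPdist_le => e e0.
have re : e = (Re e)%:C%C by rewrite RRe_real // gtr0_real.
have e0' : 0 < Re e by rewrite -ltcR -re.
have K0 : 0 < 1 + `|K| by rewrite ltr_wpDr.
rewrite near_withinE -nbhs_nearE; apply/nbhs_rnormP.
exists (Re e / (1 + `|K|)) => [|y yx My]; first by rewrite divr_gt0.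
rewrite -SB // rnormE re lecR; apply: (le_trans (SK _ (subspaceB Mx My))).
rewrite rnormBC; move: yx; rewrite ltr_pdivlMr // mulrC => /ltW; apply: le_trans.
rewrite ler_wpM2r ?rnorm_ge0 // (le_trans (ler_norm _)) // lerDr //.
Qed.

End Subspaces.

Section Regular.
Variables (R : realType) (V : completeNormedModType R[i]).
Implicit Types (M : set V) (A : {linear V -> V}) (z w : R[i]) (K : R).

Lemma resolventB A z u v :
  A (u - v) - z *: (u - v) = (A u - z *: u) - (A v - z *: v).
Proof. by rewrite linearB scalerBr !opprD !opprK addrACA. Qed.

Lemma resolvent_eqB A z u v :
  A u - z *: u = A v - z *: v -> A (u - v) = z *: (u - v).
Proof. by move=> E; apply/eqP; rewrite -subr_eq0 resolventB E subrr. Qed.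

Definition bounded_by A K := forall x, rnorm (A x) <= K * rnorm x.

(** Expresses that the restriction has a resolvent at [z] of norm at most [K] without naming an
    inverse operator: only solutions and their bounds have to be produced. *)
Definition regular_at M A z K :=
  (forall x, M x -> exists2 u, M u & A u - z *: u = x /\ rnorm u <= K * rnorm x) /\
  (forall d, M d -> A d = z *: d -> d = 0).

(** A continuous inverse is bounded, which gives [K]. Conversely, solutions are selected by choice,
    and the trivial kernel makes the selection linear and a two-sided inverse. *)
Lemma notin_spectrum_onP M A z : closed_subspace M -> op_invariant A M ->
  ~ spectrum_on M A z <-> exists2 K, 0 <= K & regular_at M A z K.
Proof.
move=> cM AM; have sM := closed_lin_subspace cM; have [M0 ML] := sM.
split.
  move=> /contrapT[S [SM Slin Sc SA AS]].
  have [K K0 SK] := continuous_subspace_bounded sM Slin Sc.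
  exists K => //; split=> [x Mx|w Mw Aw].
    by exists (S x); [exact: SM|split; [exact: AS|exact: SK]].
  rewrite -(SA w Mw) Aw subrr.
  by apply/eqP; rewrite -rnorm_eq0 eq_le rnorm_ge0 andbT (le_trans (SK _ M0)) // rnorm0 mulr0.
move=> [K K0 [ex inj]]; apply.
have /choice[S HS] : forall x, exists u, M x ->
    [/\ M u, A u - z *: u = x & rnorm u <= K * rnorm x].
  move=> x; case: (EM (M x)) => [/ex[u Mu [? ?]]|nMx]; first by exists u.
  by exists 0.
have inj' u v : M u -> M v -> A u - z *: u = A v - z *: v -> u = v.
  move=> Mu Mv E; apply/eqP; rewrite -subr_eq0; apply/eqP/inj.
    exact: subspaceB.
  exact: resolvent_eqB.
have Slin a x y : M x -> M y -> S (a *: x + y) = a *: S x + S y.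
  move=> Mx My; have [Sx ASx _] := HS x Mx; have [Sy ASy _] := HS y My.
  have [Sxy ASxy _] := HS _ (ML a _ _ Mx My).
  apply: inj' => //; first exact: ML.
  rewrite ASxy linearP scalerDr opprD addrACA ASy scalerA [z * a]mulrC -scalerA.
  by rewrite -scalerBr ASx.
exists S; split=> //.
- by move=> x /HS[].
- apply: (@bounded_subspace_continuous _ _ _ sM S K); last by move=> x /HS[].
  move=> x y Mx My; rewrite -[x - y]addrC -scaleN1r Slin // scaleN1r addrC //.
- move=> x Mx; have MAx : M (A x - z *: x).
    by apply: subspaceB => //; [exact: AM|exact: subspaceZ].
  by have [? ? _] := HS _ MAx; exact: inj'.
- by move=> x /HS[].
Qed.

Lemma closed_seq_lim M (u : nat -> V) l : closed M -> (forall n, M (u n)) ->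
  (forall e : R, 0 < e -> exists n, rnorm (u n - l) <= e) -> M l.
Proof.
move=> cM Mu ul; rewrite (closure_id M).1 //; apply/closure_rnormP => e e0.
have [|n un] := ul (e / 2); first by rewrite divr_gt0.
exists (u n) => //; apply: (le_lt_trans un).
by rewrite ltr_pdivrMr // ltr_pMr // ltr1n.
Qed.

Lemma contraction_fixpoint M (G : V -> V) (q : R) : closed M -> M !=set0 ->
  0 <= q -> q < 1 -> (forall x, M x -> M (G x)) ->
  (forall x y, M x -> M y -> rnorm (G x - G y) <= q * rnorm (x - y)) ->
  exists2 u, M u & G u = u.
Proof.
move=> cM [x0 Mx0] q0 q1 GM Gq.
pose s n := iter n G x0.
have Ms n : M (s n) by elim: n => //= n; exact: GM.
pose v n := s n.+1 - s n.
have vq n : rnorm (v n) <= rnorm (G x0 - x0) * q ^+ n.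
  elim: n => [|n ih]; first by rewrite expr0 mulr1.
  rewrite -[v n.+1]/(G (s n.+1) - G (s n)).
  apply: (le_trans (Gq _ _ (Ms _) (Ms _))).
  by rewrite exprS mulrCA ler_wpM2l.
have [l Hl] := geometric_series_cvg q0 q1 vq.
have {}Hl n : rnorm (s n - (l + x0)) <= rnorm (G x0 - x0) / (1 - q) * q ^+ n.
  have := Hl n; rewrite rnormBC.
  suff -> : \sum_(k < n) v k = s n - x0 by rewrite opprD addrA addrAC.
  elim: n => [|n ih]; first by rewrite big_ord0 subrr.
  by rewrite big_ord_recr /= ih addrC /v subrKA.
set u := l + x0 in Hl.
have ul e : 0 < e -> exists N, forall n, (N <= n)%N -> rnorm (s n - u) <= e.
  move=> e0; have [N HN] := @geometric_lt R q e (rnorm (G x0 - x0) / (1 - q)) q0 q1 e0.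
  by exists N => n /HN; apply: le_trans.
have Mu : M u.
  apply: (closed_seq_lim cM Ms) => e /ul[N HN]; exists N; exact: HN.
exists u => //; apply/eqP; rewrite -subr_eq0; apply/eqP/rnorm_small => e e0.
have [N HN] := ul (e / 2) (divr_gt0 e0 (ltr0Sn R 1)).
rewrite -[G u](subrK (s N.+1)) -addrA; apply: (le_trans (rnormD _ _)).
have -> : e = e / 2 + e / 2 by field.
rewrite lerD //; last exact: HN.
apply: (le_trans (Gq _ _ Mu (Ms _))); rewrite rnormBC.
by apply: (le_trans _ (HN N (leqnn N))); rewrite ler_piMl ?rnorm_ge0 // ltW.
Qed.

(** With [S] the resolvent at [z], the equation at [w] reads [u = S (x + (w - z) *: u)], a fixed
    point problem for a contraction of factor [cnorm (w - z) * K]. The same identity bounds the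
    solution. *)
Lemma regular_perturb M A z w K : closed_subspace M ->
  0 <= K -> regular_at M A z K -> cnorm (w - z) * K < 1 ->
  regular_at M A w (K / (1 - cnorm (w - z) * K)).
Proof.
move=> cM K0 [ex inj] q1; have sM := closed_lin_subspace cM; have [M0 ML] := sM.
set q := cnorm (w - z) * K in q1 *.
have q0 : 0 <= q by rewrite mulr_ge0 ?rnorm_ge0.
have q1' : 0 < 1 - q by rewrite subr_gt0.
have /choice[S HS] : forall x, exists u, M x ->
    [/\ M u, A u - z *: u = x & rnorm u <= K * rnorm x].
  move=> x; case: (EM (M x)) => [/ex[u Mu [? ?]]|nMx]; first by exists u.
  by exists 0.
have inj' u v : M u -> M v -> A u - z *: u = A v - z *: v -> u = v.
  move=> Mu Mv E; apply/eqP; rewrite -subr_eq0; apply/eqP/inj.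
    exact: subspaceB.
  exact: resolvent_eqB.
have SB x y : M x -> M y -> rnorm (S x - S y) <= K * rnorm (x - y).
  move=> Mx My; have [Sx ASx _] := HS x Mx; have [Sy ASy _] := HS y My.
  have [Sxy ASxy] := HS _ (subspaceB sM Mx My).
  suff -> : S x - S y = S (x - y) by [].
  apply: inj' => //; first exact: subspaceB.
  by rewrite resolventB ASx ASy ASxy.
have S0 : S 0 = 0.
  have [_ _] := HS 0 M0; rewrite rnorm0 mulr0 => h.
  by apply/eqP; rewrite -rnorm_eq0 eq_le h rnorm_ge0.
have Seq u x : M u -> M x -> A u - w *: u = x -> u = S (x + (w - z) *: u).
  move=> Mu Mx E; have Mxu : M (x + (w - z) *: u).
    by apply: subspaceD => //; exact: subspaceZ.
  have [Ms E' _] := HS _ Mxu.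
  apply: inj' => //.
  by rewrite E' -E scalerBl addrA subrK.
split=> [x Mx|d Md Ad]; last first.
  have := Seq d 0 Md M0; rewrite Ad subrr => /(_ erefl).
  rewrite add0r => E; apply/eqP; rewrite -rnorm_eq0 eq_le rnorm_ge0 andbT.
  have [_ _] := HS _ (subspaceZ sM (w - z) Md); rewrite -E rnormZ mulrA.
  rewrite [K * _]mulrC -/q => h; have := rnorm_ge0 d; nra.
pose G u := S (x + (w - z) *: u).
have MG u : M u -> M (x + (w - z) *: u).
  by move=> Mu; apply: subspaceD => //; exact: subspaceZ.
have [u Mu Gu] : exists2 u, M u & G u = u.
  apply: (@contraction_fixpoint M G q) => //; first by case: cM.
  - by exists 0.
  - by move=> u Mu; have [] := HS _ (MG _ Mu).
  move=> a b Ma Mb; apply: (le_trans (SB _ _ (MG _ Ma) (MG _ Mb))).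
  by rewrite opprD addrACA subrr add0r -scalerBr rnormZ mulrA [K * _]mulrC.
exists u => //; have [_ E nu] := HS _ (MG _ Mu); rewrite -/(G u) Gu in E nu.
split; first by rewrite -[w](subrK z) scalerDl opprD addrCA addrC E addrK.
rewrite mulrAC ler_pdivlMr // mulrBr mulr1 lerBlDr.
apply: (le_trans nu); rewrite mulrC [q]mulrC mulrCA -mulrDr mulrC ler_wpM2l //.
by rewrite (le_trans (rnormD _ _)) // rnormZ lerD2l mulrC.
Qed.

(** The equation is the fixed point problem [u = z^-1 *: (A u - x)], whose contraction factor is
    [K / cnorm z]. *)
Lemma regular_large M A z K : closed_subspace M -> op_invariant A M ->
  0 <= K -> bounded_by A K -> K < cnorm z ->
  regular_at M A z (cnorm z - K)^-1.
Proof.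
move=> cM AM K0 AK Kz; have sM := closed_lin_subspace cM; have [M0 ML] := sM.
have z0 : 0 < cnorm z := le_lt_trans K0 Kz.
have zn0 : z != 0 by rewrite rnorm_gt0 in z0.
have zK : 0 < cnorm z - K by rewrite subr_gt0.
split=> [x Mx|d Md Ad]; last first.
  have := AK d; rewrite Ad rnormZ => h.
  apply/eqP; rewrite -rnorm_eq0 eq_le rnorm_ge0 andbT.
  have := rnorm_ge0 d; nra.
pose G u := z^-1 *: (A u - x).
have [u Mu Gu] : exists2 u, M u & G u = u.
  apply: (@contraction_fixpoint M G (K / cnorm z)) => //.
  - by case: cM.
  - by exists 0.
  - by rewrite divr_ge0 // ltW.
  - by rewrite ltr_pdivrMr // mul1r.
  - by move=> u Mu; apply: subspaceZ => //; apply: subspaceB => //; exact: AM.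
  move=> a b _ _; rewrite -scalerBr opprB addrA subrK -linearB rnormZ cnormV.
  by rewrite mulrC mulrAC ler_pdivlMr // divfK ?gt_eqF.
have E : z *: u = A u - x by rewrite -Gu scalerA divff // scale1r Gu.
exists u => //; split; first by rewrite E subKr.
rewrite mulrC ler_pdivlMr // mulrBr lerBlDr mulrC -rnormZ E.
by rewrite (le_trans (rnormB _ _)) // addrC lerD2l mulrC.
Qed.

(* By uniqueness, [(f w - f z) / (w - z)] is the solution at [w] with right-hand side
   [f z]; applying this twice shows that it is Lipschitz in [w]. *)
Lemma solution_cderiv (E : set V) A z (del : R) (f : R[i]^o -> V) x :
  lin_subspace E -> 0 < del ->
  (forall v, E v -> exists C, forall w, cnorm (w - z) < del ->
     exists2 u, E u & A u - w *: u = v /\ rnorm u <= C) ->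
  (forall w, cnorm (w - z) < del -> forall d, E d -> A d = w *: d -> d = 0) ->
  (forall w, cnorm (w - z) < del -> E (f w) /\ A (f w) - w *: f w = x) ->
  exists D, has_cderiv f z D.
Proof.
move=> sE del0 ex inj fx.
have inj' w u v : cnorm (w - z) < del -> E u -> E v ->
    A u - w *: u = A v - w *: v -> u = v.
  move=> wz Eu Ev h; apply/eqP; rewrite -subr_eq0; apply/eqP/(inj w) => //.
    exact: subspaceB.
  exact: resolvent_eqB.
have zz : cnorm (z - z) < del by rewrite subrr rnorm0.
have slope v g : (forall w, cnorm (w - z) < del -> E (g w) /\ A (g w) - w *: g w = v) ->
    exists2 phi : R[i] -> V, (forall w, cnorm (w - z) < del ->
      E (phi w) /\ A (phi w) - w *: phi w = g z) & exists C,
    forall w, cnorm (w - z) < del -> g w - g z = (w - z) *: phi w /\ rnorm (phi w) <= C.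
  move=> gv; have [Egz gz] := gv z zz; have [C HC] := ex _ Egz.
  have /choice[phi Hphi] : forall w, exists u, cnorm (w - z) < del ->
      [/\ E u, A u - w *: u = g z & rnorm u <= C].
    move=> w; case: (EM (cnorm (w - z) < del)) => [/HC[u Eu [? ?]]|?]; first by exists u.
    by exists 0.
  exists phi; first by move=> w /Hphi[].
  exists C => w wz; have [Ep Ap pC] := Hphi w wz; split=> //.
  have [Egw gw] := gv w wz.
  apply: (inj' w) => //; [exact: subspaceB|exact: subspaceZ|].
  have -> : A ((w - z) *: phi w) - w *: ((w - z) *: phi w) = (w - z) *: g z.
    by rewrite -Ap scalerBr linearZ /= !scalerA [w * _]mulrC.
  have gw' : A (g w) = v + w *: g w by rewrite -gw subrK.
  have gz' : A (g z) = v + z *: g z by rewrite -gz subrK.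
  rewrite linearB /= gw' gz' [- (v + _)]opprD [v + _ + _]addrACA subrr add0r.
  by rewrite [w *: (_ - _)]scalerBr opprB [LHS]addrC subrKA -scalerBl.
have [phi Hphi [C HC]] := slope x f fx.
have [psi Hpsi [C' HC']] := slope _ phi Hphi.
exists (phi z); apply: (@has_cderiv_slope _ _ f z phi del C') => //.
  by move=> w /HC[].
move=> w wz; have [-> pC] := HC' w wz; by rewrite rnormZ mulrC ler_wpM2r ?rnorm_ge0.
Qed.

End Regular.

Section Resolvent.
Variables (R : realType) (V : completeNormedModType R[i]).
Implicit Types (M : set V) (A : {linear V -> V}) (z w : R[i]) (K : R).

Lemma regular_near M A z K : closed_subspace M -> 0 <= K -> regular_at M A z K ->
  exists2 del : R, 0 < del & forall w, cnorm (w - z) < del -> regular_at M A w (2 * K).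
Proof.
move=> cM K0 rz; have K1 : 0 < 2 * (K + 1) by rewrite mulr_gt0 // ltr_wpDl.
(* With [K + 1] the radius is positive even for [K = 0]. On this disc [cnorm (w - z) * K] is at most
   one half, so the bound at most doubles. *)
exists (2 * (K + 1))^-1; first by rewrite invr_gt0.
move=> w; rewrite -[_^-1]mul1r ltr_pdivlMr // => wz.
have n0 := rnorm_ge0 ((w - z : R[i]) : R[i]^o).
have q1 : cnorm (w - z) * K <= 2^-1 by nra.
have q2 : cnorm (w - z) * K < 1 by lra.
have [ex inj] := regular_perturb cM K0 rz q2; split=> // x /ex[u Mu [E b]].
exists u => //; split=> //; apply: (le_trans b); rewrite ler_wpM2r ?rnorm_ge0 //.
rewrite ler_pdivrMr ?subr_gt0 //; nra.
Qed.

Lemma spectrum_on_closed M A : closed_subspace M -> op_invariant A M ->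
  closed (spectrum_on M A).
Proof.
move=> cM AM; rewrite -[X in closed X]setCK closedC; apply/open_rnormP => z.
move=> /(notin_spectrum_onP _ cM AM)[K K0 /(regular_near cM K0)[del del0 H]].
exists del => // w /H rw; apply/(notin_spectrum_onP _ cM AM); exists (2 * K) => //.
by rewrite mulr_ge0.
Qed.

Lemma spectrum_on_norm_le M A K z : closed_subspace M -> op_invariant A M ->
  0 <= K -> bounded_by A K -> spectrum_on M A z -> cnorm z <= K.
Proof.
move=> cM AM K0 AK; apply: contraPle => Kz.
apply/(notin_spectrum_onP _ cM AM); exists (cnorm z - K)^-1.
  by rewrite invr_ge0 subr_ge0 ltW.
exact: regular_large.
Qed.

Lemma resolvent_exists M A x : closed_subspace M -> op_invariant A M -> M x ->
  exists f : R[i]^o -> V, forall z, ~ spectrum_on M A z ->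
    M (f z) /\ A (f z) - z *: f z = x.
Proof.
move=> cM AM Mx.
have /choice[f Hf] : forall z, exists u, ~ spectrum_on M A z -> M u /\ A u - z *: u = x.
  move=> z; case: (EM (spectrum_on M A z)) => [?|]; first by exists 0.
  by move=> /(notin_spectrum_onP _ cM AM)[K _ [ex _]]; have [u Mu [Eu _]] := ex _ Mx; exists u.
by exists f.
Qed.

Lemma resolvent_cderiv M A x (f : R[i]^o -> V) : closed_subspace M -> op_invariant A M ->
  (forall z, ~ spectrum_on M A z -> M (f z) /\ A (f z) - z *: f z = x) ->
  forall z, ~ spectrum_on M A z -> exists D, has_cderiv f z D.
Proof.
move=> cM AM fx z /(notin_spectrum_onP _ cM AM)[K K0 /(regular_near cM K0)[del del0 H]].
apply: (solution_cderiv (closed_lin_subspace cM) del0 (A := A) (x := x)).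
- move=> v Mv; exists (2 * K * rnorm v) => w /H[ex _]; exact: ex.
- by move=> w /H[].
move=> w /H rw; apply: fx; apply/(notin_spectrum_onP _ cM AM).
by exists (2 * K) => //; rewrite mulr_ge0.
Qed.

(** Off the spectrum of the restriction, the resolvent on [M] applied to [x] is an analytic local
    solution. *)
Lemma local_spectrum_sub M A x : closed_subspace M -> op_invariant A M -> M x ->
  local_spectrum A x `<=` spectrum_on M A.
Proof.
move=> cM AM Mx z; apply: contra_notP => nz.
have [f fx] := resolvent_exists cM AM Mx.
exists (~` spectrum_on M A), f; split=> //.
- by rewrite openC; exact: spectrum_on_closed.
- by move=> w nw; apply/derivable_cderiv; exact: (resolvent_cderiv cM AM fx).
- by move=> w /fx[].
Qed.

(** Any solution satisfies [cnorm z * rnorm u <= K * rnorm u + rnorm x]. This supplies the decay at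
    infinity for Liouville's theorem and Cauchy's estimate. *)
Lemma solution_decay A K z x u : bounded_by A K -> K < cnorm z ->
  A u - z *: u = x -> rnorm u <= rnorm x / (cnorm z - K).
Proof.
move=> AK Kz E; rewrite ler_pdivlMr ?subr_gt0 // mulrBr lerBlDr mulrC -rnormZ.
have -> : z *: u = A u - x by rewrite -E subKr.
by rewrite (le_trans (rnormB _ _)) // addrC lerD2l mulrC.
Qed.

End Resolvent.

(** * Vectors with geometrically bounded orbits *)

Section Orbits.
Variables (R : realType) (V : completeNormedModType R[i]).
Variables (A : {linear V -> V}) (K : R).
Hypotheses (K0 : 0 <= K) (AK : bounded_by A K).
Implicit Types (v u : V) (s C : R).

Lemma iter_linear n : linear (iter n A).
Proof. by elim: n => [|n ih] a x y //=; rewrite ih linearP. Qed.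

Lemma iterB n u v : iter n A (u - v) = iter n A u - iter n A v.
Proof. by elim: n => //= n ->; rewrite linearB. Qed.

Lemma iterZ n a v : iter n A (a *: v) = a *: iter n A v.
Proof. by elim: n => //= n ->; rewrite linearZ. Qed.

Lemma iter_sum n m (F : nat -> V) :
  iter n A (\sum_(k < m) F k) = \sum_(k < m) iter n A (F k).
Proof. by elim: n => //= n ->; rewrite linear_sum. Qed.

Lemma iter_bound n v : rnorm (iter n A v) <= K ^+ n * rnorm v.
Proof.
elim: n => [|n ih]; first by rewrite expr0 mul1r.
by rewrite exprS -mulrA; apply: (le_trans (AK _)); rewrite ler_wpM2l.
Qed.

(** For [s < cnorm z] the operator [A - z] is bijective on this space, as the next lemmas show; it
    thus acts as a spectral subspace for the disc of radius [s]. *)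
Definition orbit_space s : set V :=
  [set v | exists C, forall n, rnorm (iter n A v) <= C * s ^+ n].

Lemma orbit_subspace s : 0 <= s -> lin_subspace (orbit_space s).
Proof.
move=> s0; split.
  exists 0 => n; suff -> : iter n A 0 = 0 by rewrite rnorm0 mul0r.
  by elim: n => //= n ->; rewrite linear0.
move=> a x y [C HC] [D HD]; exists (cnorm a * C + D) => n.
rewrite iter_linear mulrDl (le_trans (rnormD _ _)) // lerD // rnormZ -mulrA.
by rewrite ler_wpM2l // rnorm_ge0.
Qed.

(** The orbit of an eigenvector grows like [cnorm z ^+ n], faster than [s ^+ n]. *)
Lemma orbit_eigen s z d : 0 <= s -> s < cnorm z -> orbit_space s d ->
  A d = z *: d -> d = 0.
Proof.
move=> s0 sz [C HC] Ad; have z0 := le_lt_trans s0 sz.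
have Ed n : iter n A d = z ^+ n *: d.
  by elim: n => [|n ih]; rewrite ?scale1r //= ih linearZ /= Ad scalerA exprSr.
apply: rnorm_small => e e0.
have q0 : 0 <= s / cnorm z by rewrite divr_ge0 // ltW.
have q1 : s / cnorm z < 1 by rewrite ltr_pdivrMr // mul1r.
have [N HN] := @geometric_lt R (s / cnorm z) e C q0 q1 e0.
apply: le_trans (HN N (leqnn N)).
rewrite expr_div_n mulrA ler_pdivlMr ?exprn_gt0 // mulrC -cnormX -rnormZ -Ed.
exact: HC.
Qed.

(** The Neumann series of the resolvent, applied to [v], converges because the orbit of [v] grows
    more slowly than the powers of [z]. *)
Lemma orbit_solution s z v C : 0 <= s -> s < cnorm z ->
  (forall n, rnorm (iter n A v) <= C * s ^+ n) ->
  exists2 u, A u - z *: u = v &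
    forall n, rnorm (iter n A u) <= C / (cnorm z - s) * s ^+ n.
Proof.
move=> s0 sz HC; have z0 := le_lt_trans s0 sz.
have zn0 : z != 0 by rewrite rnorm_gt0 in z0.
set q := s / cnorm z.
have q0 : 0 <= q by rewrite divr_ge0 // ltW.
have q1 : q < 1 by rewrite ltr_pdivrMr // mul1r.
pose t k := - (z^-1 ^+ k.+1 *: iter k A v).
have tb n k : rnorm (iter n A (t k)) <= C * s ^+ n / cnorm z * q ^+ k.
  rewrite /t -scaleN1r !iterZ !rnormZ -iterD cnormX cnormV.
  have -> : cnorm (-1 : R[i]) = 1 by rewrite rnormN cnorm1.
  rewrite mul1r; apply: (@le_trans _ _ ((cnorm z)^-1 ^+ k.+1 * (C * s ^+ (n + k)))).
    by rewrite ler_wpM2l // exprn_ge0 // invr_ge0 ltW.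
  rewrite le_eqVlt; apply/orP; left; apply/eqP.
  by rewrite /q expr_div_n exprS exprD exprVn; field; rewrite expf_neq0 gt_eqF.
(* The image of the series under each [iter n A] is summed separately, with the factor [s ^+ n] in
   its bound; its sum is identified with [iter n A u] further down. *)
have lim n := geometric_series_cvg q0 q1 (tb n).
have [u Hu] := lim 0%N; exists u.
  apply/eqP; rewrite -subr_eq0; apply/eqP/rnorm_small => e e0.
  set B := C * _ / _ / _ in Hu.
  have [N HN] := @geometric_lt R q e ((K + cnorm z) * B + C) q0 q1 e0.
  apply: le_trans (HN N (leqnn N)).
  have E : A (\sum_(k < N) t k) - z *: \sum_(k < N) t k = v - z^-1 ^+ N *: iter N A v.
    elim: N {HN} => [|N ih].
      by rewrite big_ord0 linear0 scaler0 expr0 scale1r /= !subrr.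
    have At : A (t N) = - (z^-1 ^+ N.+1 *: iter N.+1 A v).
      by rewrite /t linearN linearZ.
    have zt : z *: t N = - (z^-1 ^+ N *: iter N A v).
      by rewrite /t scalerN scalerA exprS mulrA divff // mul1r.
    rewrite big_ord_recr /= linearD scalerDr opprD addrACA ih At zt opprK.
    by rewrite [X in _ + X]addrC subrKA.
  have -> : A u - z *: u - v = A (u - \sum_(k < N) t k) - z *: (u - \sum_(k < N) t k)
      - z^-1 ^+ N *: iter N A v.
    by rewrite resolventB E opprB [X in _ = _ + X - _]addrC addrA addrK.
  have Hu' := Hu N; rewrite /= in Hu'.
  apply: (le_trans (rnormB _ _)); rewrite [X in _ <= X]mulrDl lerD //.
    apply: (le_trans (rnormB _ _)); rewrite rnormZ mulrDl mulrDl lerD //.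
      by apply: (le_trans (AK _)); rewrite -mulrA ler_wpM2l.
    by rewrite -mulrA ler_wpM2l // rnorm_ge0.
  rewrite rnormZ cnormX cnormV /q expr_div_n.
  rewrite mulrC mulrA exprVn ler_wpM2r //.
  by rewrite invr_ge0 exprn_ge0 // ltW.
move=> n; have [un Hun] := lim n.
have <- : un = iter n A u.
  apply/eqP; rewrite -subr_eq0; apply/eqP/rnorm_small => e e0.
  set B := C * _ / _ / _ in Hu; set Bn := C * _ / _ / _ in Hun.
  have [N HN] := @geometric_lt R q e (Bn + K ^+ n * B) q0 q1 e0.
  apply: le_trans (HN N (leqnn N)).
  rewrite -[un](subrK (iter n A (\sum_(k < N) t k))) -addrA -iterB.
  rewrite (le_trans (rnormD _ _)) // mulrDl lerD //; first by rewrite iter_sum Hun.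
  apply: (le_trans (iter_bound _ _)); rewrite -mulrA ler_wpM2l ?exprn_ge0 //.
  by rewrite rnormBC; exact: Hu.
have := Hun 0%N; rewrite big_ord0 subr0 mulr1 => /le_trans; apply.
rewrite le_eqVlt; apply/orP; left; apply/eqP; rewrite /q.
move: (cnorm z) z0 sz {tb lim Hu Hun q q0 q1} => r r0 sr; field.
by rewrite !gt_eqF ?subr_gt0.
Qed.

(** Within [orbit_space A s] the solution is unique even at points where [A - z] may have a kernel
    in [V], so [solution_cderiv] applies with this space. *)
Lemma orbit_local_resolvent s z v : 0 <= s -> s < cnorm z -> orbit_space s v ->
  local_resolvent A v z.
Proof.
move=> s0 sz Ev; have sE := orbit_subspace s0.
have far w : s < cnorm w -> forall u, orbit_space s u ->
    exists2 u', orbit_space s u' & A u' - w *: u' = u.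
  move=> sw u [C HC]; have [u' Eu' Hu'] := orbit_solution s0 sw HC.
  by exists u' => //; exists (C / (cnorm w - s)).
have /choice[f Hf] : forall w, exists u, s < cnorm w -> orbit_space s u /\ A u - w *: u = v.
  move=> w; case: (EM (s < cnorm w)) => [/far/(_ _ Ev)[u Eu ?]|?]; last by exists 0.
  by exists u.
(* Near [w] the modulus stays above the midpoint of [s] and [cnorm w], which bounds the solutions
   uniformly. *)
have near w : s < cnorm w -> exists2 del : R, 0 < del &
    forall w', cnorm (w' - w) < del -> (s + cnorm w) / 2 < cnorm w'.
  move=> sw; exists ((cnorm w - s) / 2); first by rewrite divr_gt0 // subr_gt0.
  move=> w' h; have := rnormD (w' : R[i]^o) (w - w'); rewrite subrKC rnormBC; lra.
exists [set w | s < cnorm w], f; split=> //.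
- apply/open_rnormP => w /= sw; have [del del0 H] := near w sw.
  by exists del => // w' /H /=; lra.
- move=> w /= sw; apply/derivable_cderiv; have [del del0 H] := near w sw.
  have H' w' : cnorm (w' - w) < del -> s < cnorm w' by move=> /H; lra.
  apply: (solution_cderiv sE del0 (A := A) (x := v)).
  - move=> u [C HC]; exists (`|C| / ((cnorm w - s) / 2)) => w' /[dup] /H' sw' /H h.
    have [u' Eu' Hu'] := orbit_solution s0 sw' HC.
    exists u'; first by exists (C / (cnorm w' - s)).
    split=> //; have := Hu' 0%N; rewrite expr0 mulr1 => /le_trans; apply.
    apply: (@le_trans _ _ (`|C| / (cnorm w' - s))).
      by rewrite ler_wpM2r ?ler_norm // invr_ge0 subr_ge0 ltW.
    by rewrite ler_wpM2l // lef_pV2 ?posrE; lra.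
  - by move=> w' /H' sw' d; exact: orbit_eigen.
  - by move=> w' /H' /Hf.
- by move=> w /= /Hf[].
Qed.

End Orbits.

(** * Local spectral radius *)

Section LimSup.
Variables (R : realType) (u : nat -> R) (B : R).
Hypothesis uB : forall n, 0 <= u n <= B.

Let ub : has_ubound (range u).
Proof. by exists B => _ [n _ <-]; case/andP: (uB n). Qed.

Let lb : has_lbound (range u).
Proof. by exists 0 => _ [n _ <-]; case/andP: (uB n). Qed.

Let le_sups m n : (m <= n)%N -> u n <= sups u m.
Proof. by move=> mn; apply: ub_le_sup; [exact: has_ubound_sdrop|exists n]. Qed.

Let sups_lb : has_lbound (range (sups u)).
Proof.
exists 0 => _ [n _ <-]; apply: le_trans (le_sups (leqnn n)).
by case/andP: (uB n).
Qed.

Let limn_supE' : limn_sup u = inf (range (sups u)).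
Proof. by apply: cvg_lim => //; exact: cvg_sups_inf. Qed.

Lemma limn_sup_lt s : limn_sup u < s -> exists N, forall n, (N <= n)%N -> u n <= s.
Proof.
rewrite limn_supE' => /inf_lt[|_ [N _ <-] Ns].
  by exists (sups u 0%N); exists 0%N.
by exists N => n /le_sups/le_trans; apply; exact: ltW.
Qed.

Lemma limn_sup_le s N : (forall n, (N <= n)%N -> u n <= s) -> limn_sup u <= s.
Proof.
move=> us; rewrite limn_supE'; apply: (@le_trans _ _ (sups u N)).
  by apply: ge_inf => //; exists N.
apply: ge_sup; first by exists (u N); exists N => /=.
by move=> _ [n /= /us ? <-].
Qed.

Lemma limn_sup_ge0 : 0 <= limn_sup u.
Proof.
rewrite limn_supE'; apply: lb_le_inf; first by exists (sups u 0%N); exists 0%N.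
by move=> _ [n _ <-]; apply: le_trans (le_sups (leqnn n)); case/andP: (uB n).
Qed.

End LimSup.

Lemma powR_root_le (R : realType) (a s : R) n : 0 <= a -> 0 <= s -> (0 < n)%N ->
  (a `^ n%:R^-1 <= s) = (a <= s ^+ n).
Proof.
move=> a0 s0 n0; rewrite -(ler_pXn2r n0) ?nnegrE ?powR_ge0 //.
by rewrite -(@powR_mulrn _ (a `^ _)) ?powR_ge0 // -powRrM mulVf ?powRr1 // pnatr_eq0 -lt0n.
Qed.

Section LocalRadius.
Variables (R : realType) (V : completeNormedModType R[i]).
Variables (A : {linear V -> V}) (K : R).
Hypotheses (K0 : 0 <= K) (AK : bounded_by A K).
Implicit Types (x : V) (s : R).

Lemma local_radius_bounded x : exists B, forall n : nat,
  0 <= (rnorm (iter n A x)) `^ n%:R^-1 <= B.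
Proof.
exists ((1 + K) * (1 + rnorm x)) => n; rewrite powR_ge0 /=.
have x0 := rnorm_ge0 x.
have K1 : 1 <= 1 + K by rewrite lerDl.
have x1 : 1 <= 1 + rnorm x by rewrite lerDl.
(* At index [0] the exponent is [0^-1 = 0] and the term is [1]. Both factors of the bound are at
   least [1], so it also dominates there. *)
case: n => [|n]; first by rewrite invr0 powRr0 mulr_ege1.
rewrite powR_root_le ?rnorm_ge0 ?mulr_ge0 ?(le_trans ler01) //.
apply: (le_trans (iter_bound K0 AK _ _)); rewrite exprMn ler_pM ?exprn_ge0 //.
  by rewrite lerXn2r ?nnegrE //; lra.
by apply: (@le_trans _ _ (1 + rnorm x)); [lra|exact: ler_eXnr].
Qed.

Lemma local_radius_ge0 x : 0 <= local_spectral_radius A x.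
Proof. by have [B /limn_sup_ge0] := local_radius_bounded x. Qed.

Lemma local_radius_orbit s x : 0 < s -> local_spectral_radius A x < s ->
  orbit_space A s x.
Proof.
move=> s0; have [B HB] := local_radius_bounded x.
move=> /(limn_sup_lt HB)[N HN].
(* The sum covers the indices up to [N], and the summand [1] the tail. Including [N] itself leaves
   only positive indices to the root estimate. *)
pose C : R := 1 + \sum_(k < N.+1) rnorm (iter k A x) / s ^+ k.
have sum0 : 0 <= \sum_(k < N.+1) rnorm (iter k A x) / s ^+ k.
  by apply: sumr_ge0 => k _; rewrite divr_ge0 ?rnorm_ge0 // exprn_ge0 // ltW.
have C1 : 1 <= C by rewrite lerDl.
exists C => n; case: (ltnP n N.+1) => [nN|Nn].
  rewrite -ler_pdivrMr ?exprn_gt0 //; apply: (@le_trans _ _ (C - 1)); last lra.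
  rewrite addrC addKr (bigD1 (Ordinal nN)) //= lerDl; apply: sumr_ge0 => k _.
  by rewrite divr_ge0 ?rnorm_ge0 // exprn_ge0 // ltW.
have n0 : (0 < n)%N by apply: leq_trans Nn.
have := HN n (ltnW Nn); rewrite powR_root_le ?rnorm_ge0 ?(ltW s0) // => h.
by apply: (le_trans h); rewrite ler_peMl // exprn_ge0 // ltW.
Qed.

(** For any [e > 0] the constant [C] is eventually absorbed by [((s + e) / s) ^+ n]. The start
    [maxn N 1] skips index [0], where the exponent is not that of a root. *)
Lemma orbit_local_radius s x : 0 <= s -> orbit_space A s x ->
  local_spectral_radius A x <= s.
Proof.
move=> s0 [C HC]; have [B HB] := local_radius_bounded x.
apply/ler_addgt0Pr => e e0; have se : 0 < s + e by rewrite ltr_wpDl.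
have q0 : 0 <= s / (s + e) by rewrite divr_ge0 // ltW.
have q1 : s / (s + e) < 1 by rewrite ltr_pdivrMr // mul1r ltrDl.
have [N HN] := @geometric_lt R (s / (s + e)) 1 C q0 q1 ltr01.
apply: (limn_sup_le HB (N := maxn N 1)) => n; rewrite geq_max => /andP[/HN h n0].
rewrite powR_root_le ?rnorm_ge0 ?(ltW se) //; apply: (le_trans (HC n)).
by move: h; rewrite expr_div_n mulrA ler_pdivrMr ?exprn_gt0 // mul1r.
Qed.

(** If [cnorm z] exceeded the radius, [x] would lie in the orbit space of their midpoint, and [z] in
    the local resolvent set. *)
Lemma local_spectrum_radius x z : local_spectrum A x z ->
  cnorm z <= local_spectral_radius A x.
Proof.
apply: contra_notT; rewrite -ltNge => rz; have r0 := local_radius_ge0 x.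
pose s := (local_spectral_radius A x + cnorm z) / 2.
have s0 : 0 < s by rewrite /s; lra.
apply: (orbit_local_resolvent K0 AK (ltW s0)); first by rewrite /s; lra.
by apply: local_radius_orbit => //; rewrite /s; lra.
Qed.

End LocalRadius.

(** * Duality *)

Lemma has_cderiv_linear (R : realType) (V W : normedModType R[i]) (L : V -> W) (c : R)
    (g : R[i]^o -> V) z D :
  (forall a x y, L (a *: x + y) = a *: L x + L y) ->
  (forall x, rnorm (L x) <= c * rnorm x) ->
  has_cderiv g z D -> has_cderiv (fun w => L (g w)) z (L D).
Proof.
move=> Llin Lc gD e e0; have c0 : 0 < 1 + `|c| by rewrite ltr_wpDr.
have [del del0 H] := gD _ (divr_gt0 e0 c0); exists del => // w /H h.
have LB x y : L (x - y) = L x - L y.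
  by rewrite addrC -scaleN1r Llin scaleN1r addrC.
have LZ a x : L (a *: x) = a *: L x.
  have L0 : L 0 = 0 by rewrite -(subrr 0) LB subrr.
  by rewrite -[a *: x]addr0 Llin L0 addr0.
rewrite -LZ -!LB; apply: (le_trans (Lc _)).
apply: (@le_trans _ _ ((1 + `|c|) * rnorm (g w - g z - (w - z) *: D))).
  by rewrite ler_wpM2r ?rnorm_ge0 // (le_trans (ler_norm _)) // lerDr.
by rewrite mulrC -ler_pdivlMr // mulrAC.
Qed.

Lemma derivable_mul_id (R : realType) (g : R[i]^o -> R[i]^o) (z : R[i]^o) :
  derivable g z 1 -> derivable (fun w : R[i]^o => w * g w : R[i]^o) z 1.
Proof.
move=> /derivable_cderiv[b gb]; apply/derivable_cderiv.
exists (g z + z * b : R[i]^o) => e e0.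
have z1 : 0 < cnorm z + 1 by rewrite ltr_wpDl ?rnorm_ge0.
have b1 : 0 < cnorm b + 1 by rewrite ltr_wpDl ?rnorm_ge0.
have [del del0 H] := gb _ (divr_gt0 (divr_gt0 e0 (ltr0Sn R 1)) z1).
exists (Num.min del (Num.min 1 (e / 2 / (cnorm b + 1)))).
  by rewrite !lt_min del0 ltr01 !divr_gt0.
move=> w; rewrite !lt_min => /and3P[/H {}H w1].
rewrite ltr_pdivlMr // => wb; set d := cnorm (w - z) in H w1 wb *.
have d0 : 0 <= d by exact: rnorm_ge0.
have -> : w * g w - z * g z - (w - z) *: (g z + z * b : R[i]^o) =
    w * (g w - g z - (w - z) *: (b : R[i]^o)) + (w - z) * ((w - z) * b).
  by rewrite -![_ *: _]/(_ * _); ring.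
have -> : e * d = e / 2 * d + e / 2 * d by field.
apply: (le_trans (rnormD _ _)); rewrite !cnormM -/d lerD //.
  apply: (@le_trans _ _ ((cnorm z + 1) * (e / 2 / (cnorm z + 1) * d))).
    rewrite ler_pM ?rnorm_ge0 // -[w](subrK z) addrC (le_trans (rnormD _ _)) //.
    by rewrite lerD2l ltW.
  move: (cnorm z + 1) z1 {H} => a a0; rewrite le_eqVlt; apply/orP; left; apply/eqP.
  by field; rewrite gt_eqF.
rewrite mulrC ler_wpM2r //; apply: le_trans (ltW wb).
by rewrite ler_wpM2l // lerDl.
Qed.

Lemma derivable_mul_exp (R : realType) n (g : R[i]^o -> R[i]^o) (z : R[i]^o) :
  derivable g z 1 -> derivable (fun w : R[i]^o => w ^+ n * g w : R[i]^o) z 1.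
Proof.
move=> dg; elim: n => [|n ih].
  rewrite (_ : (fun w => _) = g) //.
  by apply/funext => w; rewrite mul1r.
rewrite (_ : (fun w => _) = (fun w => w * (w ^+ n * g w))).
  exact: derivable_mul_id.
by apply/funext => w; rewrite exprS mulrA.
Qed.

(** Arithmetic for the radius beyond which the error in [resolvent_orbit] is at most the given
    one. *)
Lemma shift_bounds (R : realType) (s K Q t : R) : 0 < s -> 0 <= K -> 0 <= Q ->
  s + K + 1 + Q <= t -> [/\ s <= t, K < t, 0 < t - K & Q <= t - K].
Proof. by move=> s0 K0 Q0 Qt; split; lra. Qed.

Section Pairing.
Variables (R : realType) (X Y : completeNormedModType R[i]) (pair : Y -> X -> R[i]).
Hypothesis dp : dual_pairing pair.

Lemma pair_linr y a x1 x2 : pair y (a *: x1 + x2) = a * pair y x1 + pair y x2.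
Proof. by case: dp. Qed.

Lemma pair_linl a y1 y2 x : pair (a *: y1 + y2) x = a * pair y1 x + pair y2 x.
Proof. by case: dp => _ [_ []]. Qed.

Lemma pairBr y x1 x2 : pair y (x1 - x2) = pair y x1 - pair y x2.
Proof. by rewrite addrC -scaleN1r pair_linr mulN1r addrC. Qed.

Lemma pair0r y : pair y 0 = 0.
Proof. by rewrite -(subrr 0) pairBr subrr. Qed.

Lemma pairZr y a x : pair y (a *: x) = a * pair y x.
Proof. by rewrite -[a *: x]addr0 pair_linr pair0r addr0. Qed.

Lemma pairBl y1 y2 x : pair (y1 - y2) x = pair y1 x - pair y2 x.
Proof. by rewrite addrC -scaleN1r pair_linl mulN1r addrC. Qed.

Lemma pair0l x : pair 0 x = 0.
Proof. by rewrite -(subrr 0) pairBl subrr. Qed.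

Lemma pairZl y a x : pair (a *: y) x = a * pair y x.
Proof. by rewrite -[a *: y]addr0 pair_linl pair0l addr0. Qed.

Lemma pair_le y x : cnorm (pair y x) <= rnorm y * rnorm x.
Proof.
case: dp => _ [_ [_ [_ [h _]]]]; have := h y x.
by rewrite -[`|pair y x|]/(`|(pair y x : R[i]^o)|) !rnormE -rmorphM lecR.
Qed.

Lemma pair_norm_le y (c : R) : 0 <= c ->
  (forall x, cnorm (pair y x) <= c * rnorm x) -> rnorm y <= c.
Proof.
move=> c0 h; apply/ler_addgt0Pr => e e0; case: dp => _ [_ [_ [_ [_ hs]]]].
have /(hs y)[x []] : 0 < e%:C%C by rewrite ltcR.
rewrite -[`|pair y x|]/(`|(pair y x : R[i]^o)|) !rnormE.
rewrite -[1 in X in X -> _](rmorph1 (real_complex R)) -rmorphB lecR ltcR => x1.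
rewrite ltrBlDr => /ltW /le_trans; apply; rewrite lerD2r.
by apply: (le_trans (h x)); rewrite ler_piMr.
Qed.

Lemma pair_inj y1 y2 : (forall x, pair y1 x = pair y2 x) -> y1 = y2.
Proof.
move=> h; apply/eqP; rewrite -subr_eq0 -rnorm_eq0 eq_le rnorm_ge0 andbT.
apply: pair_norm_le => // x.
by rewrite pairBl h subrr rnorm0 mul0r.
Qed.

Lemma pair_surj (phi : X -> R[i]) (c : R) :
  (forall a x1 x2, phi (a *: x1 + x2) = a * phi x1 + phi x2) ->
  (forall x, cnorm (phi x) <= c * rnorm x) -> exists y, forall x, pair y x = phi x.
Proof.
move=> lin phic; case: dp => _ [_ [_ [h _]]]; apply: h => // x.
have c0 : 0 < 1 + `|c| by rewrite ltr_wpDr.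
apply/cvgrPdist_le => e e0.
have re : e = (Re e)%:C%C by rewrite RRe_real // gtr0_real.
have e0' : 0 < Re e by rewrite -ltcR -re.
rewrite -nbhs_nearE; apply/nbhs_rnormP.
exists (Re e / (1 + `|c|)) => [|x' xx]; first by rewrite divr_gt0.
have -> : phi x - phi x' = phi (x - x').
  by rewrite [x - _]addrC -[- x']scaleN1r lin mulN1r addrC.
rewrite rnormE re lecR (le_trans (phic _)) // rnormBC.
move: xx; rewrite ltr_pdivlMr // mulrC => /ltW; apply: le_trans.
by rewrite ler_wpM2r ?rnorm_ge0 // (le_trans (ler_norm _)) // lerDr.
Qed.

Lemma has_cderiv_pairl (g : R[i]^o -> Y) x z D : has_cderiv g z D ->
  has_cderiv (fun w => pair (g w) x : R[i]^o) z (pair D x).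
Proof.
apply: (@has_cderiv_linear _ _ (R[i]^o) (pair^~ x) (rnorm x)).
  by move=> a y1 y2; rewrite pair_linl.
by move=> y; rewrite mulrC pair_le.
Qed.

Lemma has_cderiv_pairr (f : R[i]^o -> X) y z D : has_cderiv f z D ->
  has_cderiv (fun w => pair y (f w) : R[i]^o) z (pair y D).
Proof.
apply: (@has_cderiv_linear _ _ (R[i]^o) (pair y) (rnorm y)).
  by move=> a x1 x2; rewrite pair_linr.
by move=> x; rewrite pair_le.
Qed.

Section Adjoint.
Variables (T : {linear X -> X}) (Ts : Y -> Y).
Hypothesis adj : forall y x, pair (Ts y) x = pair y (T x).

Lemma adjoint_linear : linear Ts.
Proof.
by move=> a y1 y2; apply: pair_inj => x; rewrite pair_linl !adj pair_linl.
Qed.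

Lemma adjoint_bounded K : 0 <= K -> bounded_by T K ->
  forall y, rnorm (Ts y) <= K * rnorm y.
Proof.
move=> K0 TK y; apply: pair_norm_le => [|x]; first by rewrite mulr_ge0 ?rnorm_ge0.
rewrite adj (le_trans (pair_le _ _)) // [K * _]mulrC -mulrA.
by rewrite ler_wpM2l ?rnorm_ge0.
Qed.

End Adjoint.

Variables (T : {linear X -> X}) (Ts : {linear Y -> Y}) (K : R).
Hypothesis adj : forall y x, pair (Ts y) x = pair y (T x).
Hypotheses (K0 : 0 <= K) (TK : bounded_by T K).

Let TsK : bounded_by Ts K.
Proof. exact: (adjoint_bounded adj). Qed.

Let opT (V : normedModType R[i]) (A : V -> V) : op_invariant A setT.
Proof. by []. Qed.

(** If [S] inverts [T - z], then composing functionals with [S] inverts [Ts - z]; injectivity of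
    [Ts - z] comes from surjectivity of [T - z]. *)
Lemma adjoint_spectrum_sub : spectrum Ts `<=` spectrum T.
Proof.
move=> z; apply: contraPP => /(notin_spectrum_onP _ (@closed_subspace_setT R X) (@opT _ T)).
move=> [k k0 [ex inj]]; apply/(notin_spectrum_onP _ (@closed_subspace_setT R Y) (@opT _ Ts)).
exists k => //; split=> [y _|d _ Ed].
  have /choice[S HS] : forall x, exists u, T u - z *: u = x /\ rnorm u <= k * rnorm x.
    by move=> x; have [u _ Hu] := ex x Logic.I; exists u.
  have inj' u v : T u - z *: u = T v - z *: v -> u = v.
    by move=> /resolvent_eqB E; apply/eqP; rewrite -subr_eq0; apply/eqP/inj.
  have [|x|y' Hy'] := @pair_surj (fun x => pair y (S x)) (rnorm y * k).
  - move=> a x1 x2; rewrite -pair_linr; congr pair; apply: inj'.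
    rewrite (HS _).1 linearP scalerDr opprD addrACA (HS x2).1 scalerA [z * a]mulrC.
    by rewrite -scalerA -scalerBr (HS x1).1.
  - by rewrite (le_trans (pair_le _ _)) // -mulrA ler_wpM2l ?rnorm_ge0 // (HS x).2.
  exists y' => //; split.
    apply: pair_inj => x; rewrite pairBl pairZl adj -pairZr -pairBr Hy'.
    by congr pair; apply: inj'; rewrite (HS _).1.
  apply: pair_norm_le => [|x]; first by rewrite mulr_ge0 ?rnorm_ge0.
  rewrite Hy' (le_trans (pair_le _ _)) // [k * _]mulrC -mulrA.
  by rewrite ler_wpM2l ?rnorm_ge0 // (HS x).2.
apply: pair_inj => x; rewrite pair0l; have [u _ [<- _]] := ex x Logic.I.
by rewrite pairBr pairZr -adj Ed pairZl subrr.
Qed.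

(* On the common domain [pair (g z) x = pair y (f z)], so both sides glue to an
   entire function vanishing at infinity. *)
Lemma glocal_annihilate (F1 F2 : set R[i]^o) x y : closed F1 -> closed F2 ->
  (forall z, F1 z -> ~ F2 z) ->
  glocal_subspace T F1 x -> glocal_subspace Ts F2 y -> pair y x = 0.
Proof.
move=> cF1 cF2 F12 [f [fh fx]] [g [gh gy]].
have nearC (F : set R[i]^o) z : closed F -> ~ F z ->
    exists2 del : R, 0 < del & forall w, cnorm (w - z) < del -> ~ F w.
  by rewrite -openC => /open_rnormP; exact.
pose h (z : R[i]^o) : R[i]^o := if pselect (F1 z) then pair (g z) x else pair y (f z).
have hf z : ~ F1 z -> h z = pair y (f z).
  by rewrite /h; case: pselect.
have hg z : ~ F2 z -> h z = pair (g z) x.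
  rewrite /h; case: pselect => // nF1 nF2.
  by rewrite -(gy _ nF2) -[in RHS](fx _ nF1) pairBl pairZl adj pairBr pairZr.
have hd z : derivable h z 1.
  apply/derivable_cderiv; case: (EM (F1 z)) => [/F12 nF|nF].
    have /derivable_cderiv[D HD] := gh z nF; have [del del0 H] := nearC _ _ cF2 nF.
    exists (pair D x); apply: (has_cderiv_congr del0 _ (has_cderiv_pairl x HD)).
    by move=> w /H /hg.
  have /derivable_cderiv[D HD] := fh z nF; have [del del0 H] := nearC _ _ cF1 nF.
  exists (pair y D); apply: (has_cderiv_congr del0 _ (has_cderiv_pairr y HD)).
  by move=> w /H /hf.
have nx := rnorm_ge0 x; have ny := rnorm_ge0 y.
(* The factor [1 + K] lets one bound serve twice: for [h] at infinity, and for the final estimate,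
   where [Ts] or [T] contributes a factor [K]. *)
have M0 : 0 <= rnorm x * rnorm y * (1 + K) by rewrite !mulr_ge0 // addr_ge0.
have far (e : R) : 0 < e -> exists r, K < r /\ forall z, r <= cnorm z ->
    rnorm x * rnorm y * (1 + K) / (cnorm z - K) <= e.
  move: M0; set M := _ * (1 + K) => M0 e0.
  have Me : 0 <= M / e by rewrite divr_ge0 // ltW.
  exists (K + 1 + M / e); split; first lra.
  move=> z zr; have Kz : 0 < cnorm z - K by lra.
  rewrite ler_pdivrMr // mulrC -ler_pdivrMr //; lra.
have small z : K < cnorm z -> cnorm (h z) <= rnorm x * rnorm y * (1 + K) / (cnorm z - K).
  move=> Kz; have Kz' : 0 < cnorm z - K by rewrite subr_gt0.
  apply: (@le_trans _ _ (rnorm x * rnorm y / (cnorm z - K))); last first.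
    by rewrite ler_pM2r ?invr_gt0 // ler_peMr ?mulr_ge0 // lerDl.
  case: (EM (F1 z)) => [/F12 nF|nF].
    rewrite hg // (le_trans (pair_le _ _)) // mulrC -mulrA ler_wpM2l //.
    exact: (solution_decay TsK Kz (gy _ nF)).
  rewrite hf // (le_trans (pair_le _ _)) // [rnorm x * _]mulrC -mulrA ler_wpM2l //.
  exact: (solution_decay TK Kz (fx _ nF)).
have h0 : forall z, h z = 0.
  apply: (liouville hd) => e /far[r [Kr hr]]; exists r => z rz.
  by rewrite (le_trans (small _ _)) ?hr // (lt_le_trans Kr).
(* As [h] vanishes, the term [z * h z] drops out of [pair y x]. What is left is [pair (Ts (g z)) x]
   or [pair y (T (f z))], and both decay as [z] grows. *)
apply: (@rnorm_small R (R[i]^o)) => e /far[r [Kr hr]].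
pose z : R[i]^o := r%:C%C.
have rz : cnorm z = r by rewrite cnormr gtr0_norm // (le_lt_trans K0).
have Kz : K < cnorm z by rewrite rz.
have Kz' : 0 < cnorm z - K by rewrite subr_gt0.
have {hr} := hr z; rewrite rz lexx -rz => /(_ isT); apply: le_trans.
apply: (@le_trans _ _ (K * (rnorm x * rnorm y / (cnorm z - K)))); last first.
  by rewrite mulrA ler_pM2r ?invr_gt0 // mulrC ler_wpM2l ?mulr_ge0 // lerDr.
case: (EM (F1 z)) => [/F12 nF|nF].
  have -> : pair y x = pair (Ts (g z)) x.
    by rewrite -(gy _ nF) pairBl pairZl -hg // h0 mulr0 subr0.
  rewrite (le_trans (pair_le _ _)) //.
  apply: (@le_trans _ _ (K * (rnorm y / (cnorm z - K)) * rnorm x)).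
    rewrite ler_wpM2r // (le_trans (TsK _)) // ler_wpM2l //.
    exact: (solution_decay TsK Kz (gy _ nF)).
  by rewrite -mulrA ler_wpM2l // mulrC mulrA.
have -> : pair y x = pair y (T (f z)).
  by rewrite -(fx _ nF) pairBr pairZr -hf // h0 mulr0 subr0.
rewrite (le_trans (pair_le _ _)) //.
apply: (@le_trans _ _ (rnorm y * (K * (rnorm x / (cnorm z - K))))).
  rewrite ler_wpM2l // (le_trans (TK _)) // ler_wpM2l //.
  exact: (solution_decay TK Kz (fx _ nF)).
by rewrite mulrCA ler_wpM2l // mulrCA mulrA.
Qed.

(* [z ^+ n.+1 * <(Ts - z)^-1 y, x>] differs from a function tending to [- <Ts^n y, x>]
   at infinity by a polynomial vanishing at [0], which has zero circular means. *)
Lemma resolvent_orbit (s : R) y : 0 < s -> (forall z, s <= cnorm z -> ~ spectrum Ts z) ->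
  orbit_space Ts s y.
Proof.
move=> s0 sres.
have [f fy] := resolvent_exists (@closed_subspace_setT R Y) (@opT _ Ts) (Logic.I : setT y).
have fd := resolvent_cderiv (@closed_subspace_setT R Y) (@opT _ Ts) fy.
have fE z : s <= cnorm z -> Ts (f z) = y + z *: f z.
  by move=> /sres /fy[_ <-]; rewrite subrK.
(* On the circle [f] is composed with [cexp] along a vertical segment, so its norm is continuous in
   [t] and has a maximum. *)
have [B HB] : exists B : R, forall t, 0 <= t <= 2 * pi -> rnorm (f (circ s t)) <= B.
  have : contseg 0 (2 * pi) (fun t => rnorm (f (circ s t))).
    apply: contseg_eps => t _ e e0.
    have [D HD] : exists D, has_cderiv f (cexp (ln s +i* t)%C) D.
      by apply: fd; apply: sres; rewrite cnorm_cexp /= lnK.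
    have /cderiv_continuous/(_ e e0)[del del0 H] :=
      has_cderiv_comp (cexp_has_cderiv (ln s +i* t)%C) HD.
    exists del => // t' tt.
    have /H : cnorm ((ln s +i* t')%C - (ln s +i* t)%C : R[i]) < del.
      by rewrite (le_lt_trans (cnorm_Complex_le _ _ _ _)) // subrr normr0 add0r.
    rewrite /cexp /= lnK //; apply: le_trans.
    rewrite ler_norml; apply/andP; split.
      by rewrite lerNl opprB lerBlDr rnormBC (le_trans _ (rnormD _ _)) // subrK.
    by rewrite lerBlDr (le_trans _ (rnormD _ _)) // subrK.
  move=> /EVT_max[|c _ Hc]; first by rewrite mulr_ge0 // pi_ge0.
  by exists (rnorm (f (circ s c))) => t t2; apply: Hc; rewrite in_itv.
have B0 : 0 <= B.
  by apply: le_trans (HB 0 _); rewrite ?rnorm_ge0 // lexx /= mulr_ge0 // pi_ge0.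
(* The factor [2] comes from bounding the real and imaginary parts separately; the latter is the
   real part for ['i *: x], up to sign. *)
exists (2 * (s * B)) => n; apply: pair_norm_le.
  by rewrite !mulr_ge0 // ?exprn_ge0 // ltW.
have key x : `|Re (pair (iter n Ts y) x)| <= s * B * s ^+ n * rnorm x.
  (* Since [z *: f z = Ts (f z) - y], each further factor [z] turns [iter n Ts (f z)] into the next
     iterate at the cost of [iter n Ts y]; this gives the recursion for [q]. *)
  have [q [qd q0 hq]] : exists q : R[i]^o -> R[i]^o, [/\ forall z, derivable q z 1,
      q 0 = 0 & forall z, s <= cnorm z ->
      z ^+ n.+1 * pair (f z) x - q z = z * pair (iter n Ts (f z)) x].
    elim: n => [|n [q [qd q0 hq]]].
      exists (fun=> 0); split; [by move=> z; exact: derivable_cst|by []|move=> z _].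
      by rewrite subr0 expr1.
    exists (fun z => z * (q z - pair (iter n Ts y) x)); split=> [z||z sz].
    - by apply: derivable_mul_id; apply: derivableB => //; exact: derivable_cst.
    - by rewrite mul0r.
    rewrite iterSr fE // [y + _]addrC iter_linear pair_linl mulrDr -hq //.
    by rewrite exprS; ring.
  have := @cauchy_estimate R (fun z => z ^+ n.+1 * pair (f z) x) q
     (- pair (iter n Ts y) x) s (s * B * s ^+ n * rnorm x) s0.
  rewrite [Re (- _)]raddfN normrN; apply=> //.
  - move=> z sz; apply: (@derivable_mul_exp R n.+1 (fun w => pair (f w) x : R[i]^o) z).
    apply/derivable_cderiv; have [D HD] := fd _ (sres _ sz).
    by exists (pair D x); exact: has_cderiv_pairl.
  - move=> e e0; have nx := rnorm_ge0 x; have ny := rnorm_ge0 y.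
    pose M := K ^+ n.+1 * rnorm y * rnorm x.
    have M0 : 0 <= M by rewrite !mulr_ge0 // exprn_ge0.
    have Me : 0 <= M / e by rewrite divr_ge0 // ltW.
    move: M0 Me; set Q := M / e => M0 Q0.
    exists (s + K + 1 + Q) => z zr; have {}zr : s + K + 1 + Q <= cnorm z by [].
    have [sz Kz Kz' zQ] : [/\ s <= cnorm z, K < cnorm z, 0 < cnorm z - K &
        Q <= cnorm z - K] by exact: (shift_bounds s0 K0).
    rewrite opprK hq //.
    have -> : z * pair (iter n Ts (f z)) x + pair (iter n Ts y) x =
        pair (iter n.+1 Ts (f z)) x.
      by rewrite iterSr fE // [y + _]addrC iter_linear pair_linl.
    apply: (le_trans (pair_le _ _)).
    apply: (@le_trans _ _ (K ^+ n.+1 * (rnorm y / (cnorm z - K)) * rnorm x)).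
      rewrite ler_wpM2r // (le_trans (iter_bound K0 TsK _ _)) // ler_wpM2l ?exprn_ge0 //.
      by apply: (solution_decay TsK Kz); rewrite fE // addrK.
    have -> : K ^+ n.+1 * (rnorm y / (cnorm z - K)) * rnorm x = M / (cnorm z - K).
      by rewrite /M; ring.
    by rewrite ler_pdivrMr // mulrC -ler_pdivrMr.
  move=> t t2; rewrite cnormM cnormX (cnorm_circ _ (ltW s0)).
  apply: (@le_trans _ _ (s ^+ n.+1 * (B * rnorm x))).
    rewrite ler_wpM2l ?exprn_ge0 ?(ltW s0) // (le_trans (pair_le _ _)) //.
    by rewrite ler_wpM2r ?rnorm_ge0 // HB.
  by rewrite exprS le_eqVlt; apply/orP; left; apply/eqP; ring.
move=> x; apply: (le_trans (cnorm_le _)).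
have kx := key x; have := key ('i%C *: x).
have ni : cnorm ('i%C : R[i]) = 1 by rewrite cnormE /= expr0n expr1n add0r sqrtr1.
rewrite pairZr mulrC ReiNIm normrN rnormZ ni mul1r; lra.
Qed.

End Pairing.

(** * The adjoint of an operator with dense glocal subspaces *)

Section DenseGlocal.
Variables (R : realType) (X Y : completeNormedModType R[i]) (pair : Y -> X -> R[i]).
Variables (T : {linear X -> X}) (Ts : {linear Y -> Y}) (K : R).
Hypotheses (dp : dual_pairing pair) (adj : forall y x, pair (Ts y) x = pair y (T x)).
Hypotheses (K0 : 0 <= K) (TK : bounded_by T K).
Hypothesis glocal_dense : forall U : set (R[i])^o, U !=set0 ->
  (exists O : set (R[i])^o, open O /\ U = O `&` spectrum T) ->
  dense (glocal_subspace T (closure U)).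

Lemma glocal_eq0 (F : set R[i]^o) y : closed F -> F `<` spectrum Ts ->
  glocal_subspace Ts F y -> y = 0.
Proof.
move=> cF [FT TF] Gy.
have [l [Tl Fl]] : exists l, spectrum Ts l /\ ~ F l.
  apply: contrapT => h; apply: TF => l Tl; apply: contrapT => Fl; apply: h.
  by exists l.
have : open (~` F) by rewrite openC.
move=> /open_rnormP/(_ l Fl)[e e0 He].
(* Half the radius, so that points of the closure of [U] are still within [e] of [l] and hence
   outside [F]. *)
pose O : set R[i]^o := [set w | cnorm (w - l) < e / 2].
pose U := O `&` spectrum T.
have oO : open O.
  apply/open_rnormP => w /= wl; exists (e / 2 - cnorm (w - l)).
    by rewrite subr_gt0.
  move=> w' h; rewrite /O /= -[w' - l](subrKA w) (le_lt_trans (rnormD _ _)) //.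
  by rewrite -ltrBrDr.
have U0 : U !=set0.
  exists l; split; last exact: (adjoint_spectrum_sub dp adj).
  by rewrite /O /= subrr rnorm0 divr_gt0.
have dU := glocal_dense U0 (ex_intro _ O (conj oO erefl)).
have UF z : closure U z -> ~ F z.
  move=> /closure_rnormP/(_ (e / 2) (divr_gt0 e0 (ltr0Sn R 1)))[u [Ou _] uz].
  apply: He; rewrite -[z - l](subrKA u) (le_lt_trans (rnormD _ _)) //.
  rewrite rnormBC -[e](@divfK _ 2) // mulr_natr mulr2n ltrD //.
apply: (pair_inj dp) => x; rewrite (pair0l dp).
apply: (@rnorm_small R (R[i]^o)) => d d0.
have y1 : 0 < 1 + rnorm y by rewrite ltr_wpDr ?rnorm_ge0.
have [||x' [/= xx Gx]] := dU [set x' | rnorm (x' - x) < d / (1 + rnorm y)].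
- by exists x; rewrite /= subrr rnorm0 divr_gt0.
- apply/open_rnormP => w /= wl; exists (d / (1 + rnorm y) - rnorm (w - x)).
    by rewrite subr_gt0.
  move=> w' h; rewrite -[w' - x](subrKA w) (le_lt_trans (rnormD _ _)) //.
  by rewrite -ltrBrDr.
have E : pair y x' = 0.
  exact: (glocal_annihilate dp adj K0 TK (@closed_closure _ U) cF UF Gx Gy).
rewrite -[pair y x]subr0 -E -(pairBr dp) (le_trans (pair_le dp _ _)) // rnormBC.
move: xx; rewrite ltr_pdivlMr // mulrC => /ltW; apply: le_trans.
by rewrite ler_wpM2r ?rnorm_ge0 // lerDr.
Qed.

Let opTs : op_invariant Ts setT. Proof. by []. Qed.
Let cY := @closed_subspace_setT R Y.

Lemma eigen_singleton y l : y != 0 -> Ts y = l *: y -> spectrum Ts = [set l].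
Proof.
move=> y0 Ey; have ll : spectrum Ts l.
  apply: contrapT => /(notin_spectrum_onP _ cY opTs)[k _ [_ inj]].
  by move/eqP : y0; apply; exact: inj.
apply: contrapT => ne; move/eqP : y0; apply.
have cl : closed ([set l] : set R[i]^o).
  by apply: accessible_closed_set1; apply: hausdorff_accessible; exact: norm_hausdorff.
apply: (glocal_eq0 cl).
  split; first by move=> _ ->.
  by move=> h; apply: ne; apply/seteqP; split=> // _ ->.
exists (fun z => (l - z)^-1 *: y); split=> [z zl|z zl]; last first.
  have lz : l - z != 0 by rewrite subr_eq0; apply: contra_notN zl => /eqP.
  by rewrite linearZ /= Ey !scalerA -scalerBl [_ * l]mulrC -mulrBl divff ?scale1r.
have lz : l - z != 0 by rewrite subr_eq0; apply: contra_notN zl => /eqP.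
have lz0 : 0 < cnorm (l - z) by rewrite rnorm_gt0.
apply/derivable_cderiv.
(* The difference quotient of [(l - w)^-1 *: y]. It is Lipschitz at [z] on a disc of half the
   distance from [z] to [l]. *)
pose phi w := ((l - w)^-1 * (l - z)^-1) *: y.
have far w : cnorm (w - z) < cnorm (l - z) / 2 -> cnorm (l - z) / 2 < cnorm (l - w).
  move=> h; have := rnormD (l - w : R[i]^o) (w - z); rewrite addrA subrK; lra.
have del0 : 0 < cnorm (l - z) / 2 by rewrite divr_gt0.
have slope w : cnorm (w - z) < cnorm (l - z) / 2 ->
    (l - w)^-1 - (l - z)^-1 = (w - z) * ((l - w)^-1 * (l - z)^-1).
  move=> /far h; have lw : l - w != 0 by rewrite -(@rnorm_gt0 _ (R[i]^o)) (lt_trans del0).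
  by field; rewrite lz lw.
exists (phi z); apply: (@has_cderiv_slope _ _ _ z phi _
   (2 / cnorm (l - z) * cnorm (l - z)^-1 * cnorm (l - z)^-1 * rnorm y) del0) => w h.
  by rewrite -scalerBl slope // scalerA.
rewrite /phi -scalerBl -mulrBl slope // rnormZ !cnormM.
have fw := far w h.
have i1 : cnorm (l - w)^-1 <= 2 / cnorm (l - z).
  rewrite cnormV -[2 / _]invrK invf_div lef_pV2 ?posrE ?(lt_trans del0 fw) //.
  exact: ltW.
set a := cnorm (l - w)^-1 in i1 *; set b := cnorm (l - z)^-1; set B := 2 / _ in i1 *.
have -> : cnorm (w - z) * (a * b) * b * rnorm y = a * (b * b * rnorm y * cnorm (w - z)).
  by ring.
have -> : B * b * b * rnorm y * cnorm (w - z) = B * (b * b * rnorm y * cnorm (w - z)).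
  by ring.
by rewrite ler_wpM2r // !mulr_ge0 // rnorm_ge0.
Qed.

(** A nonzero value at [z] persists by continuity at some [w] distinct from [z]. Both would be
    eigenvalues, and each would be the whole spectrum. *)
Lemma adjoint_svep (U : set R[i]^o) (f : R[i]^o -> Y) : open U -> holo_on U f ->
  (forall z, U z -> Ts (f z) = z *: f z) -> forall z, U z -> f z = 0.
Proof.
move=> oU hf Ef z Uz; apply: contrapT => /eqP fz.
have fz0 : 0 < rnorm (f z) by rewrite rnorm_gt0.
have /derivable_cderiv[D HD] := hf z Uz.
have [d1 d10 H1] := cderiv_continuous HD (divr_gt0 fz0 (ltr0Sn R 1)).
have [d2 d20 H2] : exists2 d : R, 0 < d & forall w, cnorm (w - z) < d -> U w.
  by move/open_rnormP : oU => /(_ z Uz).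
pose r := Num.min d1 d2 / 2.
have m0 : 0 < Num.min d1 d2 by rewrite lt_min d10.
have r0 : 0 < r by rewrite divr_gt0.
have rm : r < Num.min d1 d2 by rewrite ltr_pdivrMr // ltr_pMr // ltr1n.
pose w := z + r%:C%C.
have wz : cnorm (w - z) = r by rewrite /w addrC addKr cnormr gtr0_norm.
have fw : f w != 0.
  have /H1 : cnorm (w - z) < d1 by rewrite wz (lt_le_trans rm) // ge_min lexx.
  apply: contraTneq => ->; rewrite sub0r rnormN -ltNge.
  by rewrite ltr_pdivrMr // ltr_pMr // ltr1n.
have Uw : U w by apply: H2; rewrite wz (lt_le_trans rm) // ge_min lexx orbT.
have := eigen_singleton fz (Ef z Uz); rewrite (eigen_singleton fw (Ef w Uw)).
move=> /seteqP[/(_ w erefl) /= wez _].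
by move: r0; rewrite -wz wez subrr rnorm0 ltxx.
Qed.

Lemma adjoint_local_spectrum y : y != 0 -> local_spectrum Ts y = spectrum Ts.
Proof.
move=> y0; have sub : local_spectrum Ts y `<=` spectrum Ts.
  by apply: (local_spectrum_sub cY opTs).
apply: contrapT => ne; move/eqP : y0; apply.
have /choice[P HP] : forall z, exists Uf : set R[i]^o * (R[i]^o -> Y),
    local_resolvent Ts y z -> [/\ open Uf.1, Uf.1 z, holo_on Uf.1 Uf.2 &
      forall w, Uf.1 w -> Ts (Uf.2 w) - w *: Uf.2 w = y].
  move=> z; case: (EM (local_resolvent Ts y z)) => [[U [f [? ? ? ?]]]|?].
    by exists (U, f).
  by exists (set0, fun=> 0).
have res_open : open (local_resolvent Ts y).
  apply/open_rnormP => z [U [f [oU Uz hf Ef]]].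
  have [e e0 He] := (open_rnormP U).1 oU z Uz.
  by exists e => // w /He Uw; exists U, f.
have nF z : ~ local_spectrum Ts y z <-> local_resolvent Ts y z.
  by split=> [|h]; [exact: contrapT|apply].
apply: (@glocal_eq0 (local_spectrum Ts y)).
- by rewrite closedC.
- split=> // sub'; apply: ne; exact/seteqP.
(* The diagonal of the chosen local solutions. By [adjoint_svep] on the overlaps it coincides near
   each [z] with the analytic function chosen at [z]. *)
exists (fun z => (P z).2 z); split=> [z /nF rz|z /nF /HP[_ Uz _ Ef]]; last exact: Ef.
have [oU Uz hf Ef] := HP z rz.
have /derivable_cderiv[D HD] := hf z Uz.
have [d d0 Hd] := (open_rnormP _).1 oU z Uz.
apply/derivable_cderiv; exists D; apply: (has_cderiv_congr d0 _ HD) => w /Hd Uw.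
have rw : local_resolvent Ts y w by exists (P z).1, (P z).2.
have [oW Ww hg Eg] := HP w rw.
apply/eqP; rewrite -subr_eq0; apply/eqP.
apply: (@adjoint_svep ((P z).1 `&` (P w).1) (fun v => (P z).2 v - (P w).2 v)) => //.
- exact: openI.
- by move=> v [Uv Wv]; apply: derivableB; [exact: hf|exact: hg].
by move=> v [Uv Wv]; apply: resolvent_eqB; rewrite Ef // Eg.
Qed.

(** A local spectral subspace is the whole space if [F] contains the spectrum, and zero
    otherwise. *)
Lemma adjoint_property_C : property_C Ts.
Proof.
move=> F cF; case: (EM (spectrum Ts `<=` F)) => [sF|nF].
  rewrite (_ : local_spectral_subspace _ _ = setT); first exact: closedT.
  apply/seteqP; split=> // y _; apply: subset_trans sF.
  exact: (local_spectrum_sub cY opTs).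
rewrite (_ : local_spectral_subspace _ _ = [set 0]).
  by apply: accessible_closed_set1; apply: hausdorff_accessible; exact: norm_hausdorff.
apply/seteqP; split=> [y yF|_ -> z nz] /=.
  apply: contrapT => /eqP /adjoint_local_spectrum ys; apply: nF.
  by rewrite -ys.
exfalso; apply: nz; exists setT, (fun=> 0).
split; [exact: openT|by []|by move=> w _; exact: derivable_cst|move=> w _].
by rewrite linear0 scaler0 subrr.
Qed.

(** [resolvent_orbit] bounds orbits by every radius above the spectral one; the reverse inequality
    holds because the full spectrum is the local spectrum of [y]. *)
Lemma adjoint_local_radius y : y != 0 ->
  local_spectral_radius Ts y = spectral_radius Ts.
Proof.
move=> y0; have TsK : bounded_by Ts K by exact: (adjoint_bounded dp adj).
set S := [set complex.Re `|l| | l in spectrum Ts].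
have hS : has_ubound S.
  by exists K => _ [l sl <-]; exact: (spectrum_on_norm_le cY opTs K0 TsK sl).
have S0 : 0 <= sup S.
  case: (EM (S !=set0)) => [[_ [l sl _]]|/nonemptyPn ->]; last by rewrite sup0.
  apply: (@le_trans _ _ (cnorm l)); first exact: rnorm_ge0.
  by apply: ub_le_sup => //; exists l.
apply/eqP; rewrite eq_le; apply/andP; split.
  apply/ler_addgt0Pr => e e0; have Se : 0 < sup S + e by rewrite ltr_wpDl.
  apply: (orbit_local_radius K0 TsK (ltW Se)).
  apply: (resolvent_orbit dp adj K0 TK y Se) => z Sz sz.
  have : cnorm z <= sup S by apply: ub_le_sup => //; exists z.
  lra.
(* The supremum of the empty set is [0], so an empty spectrum leaves only nonnegativity of the local
   radius to show. *)
case: (EM (S !=set0)) => [nS|/nonemptyPn eS].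
  apply: ge_sup => // _ [l sl <-].
  by apply: (local_spectrum_radius K0 TsK); rewrite adjoint_local_spectrum.
by rewrite /spectral_radius -/S eS sup0; exact: (local_radius_ge0 K0 TsK).
Qed.

(** A nonzero vector of [M] has full local spectrum, which lies in the spectrum of the
    restriction. *)
Lemma adjoint_spectrum_restrict M : closed_subspace M -> M != [set 0] ->
  op_invariant Ts M -> spectrum Ts `<=` spectrum_on M Ts.
Proof.
move=> cM M0 MT; have [y My y0] : exists2 y, M y & y != 0.
  apply: contrapT => h; move/eqP : M0; apply; apply/seteqP; split=> [y My|_ ->].
    by apply: contrapT => /eqP y0; apply: h; exists y.
  by case: cM.
rewrite -(adjoint_local_spectrum y0); exact: (local_spectrum_sub cM MT).
Qed.

End DenseGlocal.

(** * Spectra of restrictions and the full spectrum *)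

Section FullSpectrum.
Variables (R : realType) (V : completeNormedModType R[i]).
Variables (A : {linear V -> V}) (K : R).
Hypotheses (K0 : 0 <= K) (AK : bounded_by A K).

Let opA : op_invariant A setT. Proof. by []. Qed.
Let cV := @closed_subspace_setT R V.

(* The points of the resolvent set whose resolvent preserves [M] form a clopen set
   containing all large numbers. *)
Lemma spectrum_on_full M : closed_subspace M -> op_invariant A M ->
  spectrum_on M A `<=` full_spectrum (spectrum A).
Proof.
move=> cM AM z sMz; case: (EM (spectrum A z)) => [sz|nz]; [by left|right; split=> //].
have sM := closed_lin_subspace cM.
apply: contrapT => unb; set Z := connected_component _ z in unb.
have [w Zw Kw] : exists2 w, Z w & K < cnorm w.
  apply: contrapT => h; apply: unb; exists K%:C%C; split; first by apply/complex_realP; exists K.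
  move=> x Kx w Zw /=; have wK : cnorm w <= K.
    by rewrite leNgt; apply/negP => Kw; apply: h; exists w.
  by rewrite (le_trans _ (ltW Kx)) // (rnormE (w : R[i]^o)) lecR.
have rV v : Z v -> exists2 k, 0 <= k & regular_at setT A v k.
  by move=> /connected_component_sub /(notin_spectrum_onP _ cV opA).
have clop : Z `&` (~` spectrum_on M A) = Z.
  apply: (@component_connected _ (~` spectrum A) z).
  - exists w; split=> // sw; have := spectrum_on_norm_le cM AM K0 AK sw; lra.
  - exists (~` spectrum_on M A) => //; rewrite openC; exact: spectrum_on_closed.
  exists (closure (~` spectrum_on M A)); first exact: closed_closure.
  apply/seteqP; split=> v [Zv]; first by move=> nv; split=> //; exact: subset_closure.
  move=> cv; split=> //; have [k k0 rv] := rV v Zv.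
  have [d d0 Hd] := regular_near cV k0 rv.
  have k1 : 0 < 2 * k + 1 by rewrite ltr_wpDl // mulr_ge0.
  (* This radius makes [cnorm (v - v') * (2 * k) < 1], so that a perturbation from the approximating
     point [v'] reaches [v]. *)
  have d1 : 0 < Num.min d (2 * k + 1)^-1 by rewrite lt_min d0 invr_gt0.
  have [v' nv'] := (closure_rnormP _ _).1 cv _ d1.
  rewrite lt_min => /andP[/Hd[exT injT]].
  rewrite -[_^-1]mul1r ltr_pdivlMr // => vv'.
  (* The solution in [M] is by uniqueness the one in the whole space, so the bound [2 * k], uniform
     near [v], carries over to the restriction. *)
  have rM : regular_at M A v' (2 * k).
    split=> [x Mx|x _]; last exact: injT.
    have /(notin_spectrum_onP _ cM AM)[_ _ [/(_ x Mx)[u Mu [Eu _]] _]] := nv'.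
    exists u => //; split=> //; have [u' _ [Eu' b]] := exT x Logic.I.
    suff -> : u = u' by [].
    apply/eqP; rewrite -subr_eq0; apply/eqP/injT => //.
    by apply: resolvent_eqB; rewrite Eu Eu'.
  have q1 : cnorm (v - v') * (2 * k) < 1.
    rewrite rnormBC; have := rnorm_ge0 ((v' - v : R[i]) : R[i]^o); lra.
  apply/(notin_spectrum_onP _ cM AM).
  exists (2 * k / (1 - cnorm (v - v') * (2 * k))).
    by rewrite divr_ge0 ?mulr_ge0 // subr_ge0 ltW.
  by apply: regular_perturb => //; rewrite mulr_ge0.
have : (Z `&` (~` spectrum_on M A)) z.
  by rewrite clop; exact: connected_component_refl.
by case.
Qed.

End FullSpectrum.

Unset Implicit Arguments.
Set Strict Implicit.

Theorem theorem2p1 (R : realType) (X : completeNormedModType R[i])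
    (T : {linear X -> X}) (Y : completeNormedModType R[i])
    (pair : Y -> X -> R[i]) (Tstar : Y -> Y) :
  continuous T ->
  dual_pairing pair ->
  (forall y x, pair (Tstar y) x = pair y (T x)) ->
  (forall U : set (R[i])^o, U !=set0 ->
     (exists O : set (R[i])^o, open O /\ U = O `&` spectrum T) ->
     dense (glocal_subspace T (closure U))) ->
  (forall F : set (R[i])^o, closed F -> F `<` spectrum Tstar ->
         glocal_subspace Tstar F = [set 0]) /\
      (~ (exists l, spectrum Tstar = [set l]) -> point_spectrum Tstar = set0) /\
      property_C Tstar /\
      (forall y : Y, y != 0 -> local_spectrum Tstar y = spectrum Tstar) /\
      (forall y : Y, y != 0 ->
         local_spectral_radius Tstar y = spectral_radius Tstar) /\
      (forall M : set Y, closed_subspace M -> M != [set 0] -> M != setT ->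
         op_invariant Tstar M ->
         spectrum Tstar `<=` spectrum_on M Tstar /\
         spectrum_on M Tstar `<=` full_spectrum (spectrum Tstar)).
Proof.
move=> Tcont dp adj dens.
have [K K0 TK] : exists2 K : R, 0 <= K & bounded_by T K.
  have [a x y _ _||K K0 TK] := continuous_subspace_bounded (lin_subspaceT X) (S := T).
  - exact: linearP.
  - exact: continuous_subspaceT.
  by exists K => // x; exact: TK.
have [Ts ETs] : exists Ts : {linear Y -> Y}, Tstar = Ts :> (Y -> Y).
  pose lin := GRing.isLinear.Build _ _ _ _ Tstar (adjoint_linear dp adj).
  by exists (HB.pack Tstar lin : {linear Y -> Y}).
subst Tstar.
have TsK : bounded_by Ts K := adjoint_bounded dp adj K0 TK.
split=> [F cF FT|].
  apply/seteqP; split=> [y Gy|_ ->]; first exact: (glocal_eq0 dp adj K0 TK dens cF FT).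
  exists (fun=> 0); split; first by move=> z _; exact: derivable_cst.
  by move=> z _; rewrite linear0 scaler0 subrr.
split=> [ns|].
  apply/seteqP; split=> // l [y [y0 Ey]]; apply: ns; exists l.
  exact: (eigen_singleton dp adj K0 TK dens y0 Ey).
split; first exact: (adjoint_property_C dp adj K0 TK dens).
split; first exact: (adjoint_local_spectrum dp adj K0 TK dens).
split; first exact: (adjoint_local_radius dp adj K0 TK dens).
move=> M cM M0 _ MT; split.
  exact: (adjoint_spectrum_restrict dp adj K0 TK dens cM M0 MT).
exact: (spectrum_on_full K0 TsK cM MT).
Qed.
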